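(* Let $d\ge 0$ be an integer and let $R$ be a commutative coherent and $d$-perfect ring. Every $R$-module has a Gorenstein projective precover.
   Context: A commutative ring $R$ is $d$-perfect if every flat $R$-module has projective dimension at most $d$. A ($\mathbb{Z}$-indexed) complex $P_\bullet$ of projective $R$-modules is called totally acyclic if it is acyclic and $\operatorname{Hom}_R(P_\bullet,Q)$ is acyclic for every projective $R$-module $Q$. An $R$-module $G$ is Gorenstein projective if it is isomorphic to a cycle module $\operatorname{Z}_n(P_\bullet)=\ker(P_n\to P_{n-1})$ of some totally acyclic complex $P_\bullet$ of projective $R$-modules. A Gorenstein projective precover of an $R$-module $M$ is a homomorphism $\phi\colon G\to M$ with $G$ Gorenstein projective such that $\operatorname{Hom}_R(G',G)\to\operatorname{Hom}_R(G',M)$ is surjective for every Gorenstein projective $R$-module $G'$. *)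

(* Defs.v *)
From HB Require Import structures.
From mathcomp Require Import all_boot all_order all_algebra generic_quotient.
From mathcomp Require Import boolp.

Set Implicit Arguments.
Unset Strict Implicit.
Unset Printing Implicit Defensive.

Import GRing.Theory.
Local Open Scope ring_scope.
Local Open Scope quotient_scope.

(* [comPzRingType] (the zero ring is allowed) is the type of all commutative
   rings; an R-module is an [lmodType R]. *)

(* M (x)_R N is the free commutative monoid on M x N, represented by finite
   sequences of pure tensors, modulo the congruence generated by biadditivity
   and balancedness.  Since - (x (x) y) = (- x) (x) y, it is already a group. *)
Section Tensor.
Variables (R : comPzRingType) (M N : lmodType R).

Inductive tens_rel : seq (M * N) -> seq (M * N) -> Prop :=
| tens_refl s : tens_rel s s
| tens_sym s t : tens_rel s t -> tens_rel t s
| tens_trans s t u : tens_rel s t -> tens_rel t u -> tens_rel s u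
| tens_cat s s' t t' :
    tens_rel s s' -> tens_rel t t' -> tens_rel (s ++ t) (s' ++ t')
| tens_comm s t : tens_rel (s ++ t) (t ++ s)
| tens_0l y : tens_rel [:: (0, y)] [::]
| tens_Dl x x' y : tens_rel [:: (x + x', y)] [:: (x, y); (x', y)]
| tens_Dr x y y' : tens_rel [:: (x, y + y')] [:: (x, y); (x, y')]
| tens_balanced a x y : tens_rel [:: (a *: x, y)] [:: (x, a *: y)].

Definition tens_relb : rel (seq (M * N)) := fun s t => `[< tens_rel s t >].

Lemma tens_relb_refl : reflexive tens_relb.
Proof. by move=> s; apply/asboolP; apply: tens_refl. Qed.

Lemma tens_relb_sym : symmetric tens_relb.
Proof.
by move=> s t; apply/asboolP/asboolP => h; apply: tens_sym.
Qed.

Lemma tens_relb_trans : transitive tens_relb.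
Proof.
by move=> t s u /asboolP h /asboolP k; apply/asboolP; apply: tens_trans h k.
Qed.

Canonical tens_equiv := EquivRel tens_relb
  tens_relb_refl tens_relb_sym tens_relb_trans.

Definition tensor : Type := {eq_quot tens_equiv}.
HB.instance Definition _ := Choice.on tensor.
HB.instance Definition _ := EqQuotient.on tensor.

Lemma tens_eqP s t : \pi_tensor s = \pi_tensor t <-> tens_rel s t.
Proof. by split=> [/eqmodP/asboolP | h]; last apply/eqmodP/asboolP. Qed.

Lemma tensW (P : tensor -> Prop) :
  (forall s, P (\pi_tensor s)) -> forall u, P u.
Proof. exact: quotW. Qed.

Lemma tens_repr s : tens_rel (repr (\pi_tensor s)) s.
Proof. by apply/tens_eqP; rewrite reprK. Qed.

Definition tens_oppseq (s : seq (M * N)) := [seq (- p.1, p.2) | p <- s].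
Definition tens_scaleseq a (s : seq (M * N)) := [seq (a *: p.1, p.2) | p <- s].

Definition tens_zero : tensor := \pi_tensor [::].
Definition tens_add (u v : tensor) : tensor := \pi_tensor (repr u ++ repr v).
Definition tens_opp (u : tensor) : tensor := \pi_tensor (tens_oppseq (repr u)).
Definition tens_scale (a : R) (u : tensor) : tensor :=
  \pi_tensor (tens_scaleseq a (repr u)).

Lemma tens_rel_scale a s t :
  tens_rel s t -> tens_rel (tens_scaleseq a s) (tens_scaleseq a t).
Proof.
elim=> {s t} [s|s t _ h|s t u _ h _ k|s s' t t' _ h _ k|s t|y|x x' y|x y y'|b x y].
- exact: tens_refl.
- exact: tens_sym.
- exact: tens_trans h k.
- by rewrite /tens_scaleseq !map_cat; apply: tens_cat.
- by rewrite /tens_scaleseq !map_cat; apply: tens_comm.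
- by rewrite /= scaler0; apply: tens_0l.
- by rewrite /= scalerDr; apply: tens_Dl.
- exact: tens_Dr.
- by rewrite /= scalerA mulrC -scalerA; apply: tens_balanced.
Qed.

Lemma tens_oppE s : tens_oppseq s = tens_scaleseq (-1) s.
Proof. by apply: eq_map => p; rewrite scaleN1r. Qed.

Lemma pi_add s t : tens_add (\pi_tensor s) (\pi_tensor t) = \pi_tensor (s ++ t).
Proof. by apply/tens_eqP; apply: tens_cat; apply: tens_repr. Qed.

Lemma pi_opp s : tens_opp (\pi_tensor s) = \pi_tensor (tens_oppseq s).
Proof.
by apply/tens_eqP; rewrite !tens_oppE; apply/tens_rel_scale/tens_repr.
Qed.

Lemma pi_scale a s :
  tens_scale a (\pi_tensor s) = \pi_tensor (tens_scaleseq a s).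
Proof. by apply/tens_eqP; apply/tens_rel_scale/tens_repr. Qed.

Lemma tens_addA : associative tens_add.
Proof.
elim/tensW=> s; elim/tensW=> t; elim/tensW=> u.
by rewrite !pi_add catA.
Qed.

Lemma tens_addC : commutative tens_add.
Proof.
elim/tensW=> s; elim/tensW=> t; rewrite !pi_add.
by apply/tens_eqP; apply: tens_comm.
Qed.

Lemma tens_add0 : left_id tens_zero tens_add.
Proof. by elim/tensW=> s; rewrite pi_add. Qed.

Lemma tens_addN : left_inverse tens_zero tens_opp tens_add.
Proof.
elim/tensW=> s; rewrite pi_opp pi_add; apply/tens_eqP.
elim: s => [|[x y] s IHs]; first exact: tens_refl.
rewrite /= -cat1s -(cat1s _ s).
apply: (@tens_trans _ ([:: (- x, y)] ++ [:: (x, y)] ++ (tens_oppseq s ++ s))).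
  apply: tens_cat; first exact: tens_refl.
  by rewrite !catA; apply: tens_cat; [apply: tens_comm | apply: tens_refl].
rewrite catA -[[::]]cats0; apply: tens_cat => //.
apply: tens_trans (tens_sym (tens_Dl _ _ _)) _.
by rewrite addNr; apply: tens_0l.
Qed.

HB.instance Definition _ :=
  GRing.isZmodule.Build tensor tens_addA tens_addC tens_add0 tens_addN.

Lemma tens_scaleA a b v : tens_scale a (tens_scale b v) = tens_scale (a * b) v.
Proof.
elim/tensW: v => s; rewrite !pi_scale; congr \pi_tensor.
by rewrite /tens_scaleseq -map_comp; apply: eq_map => p /=; rewrite scalerA.
Qed.

Lemma tens_scale1 : left_id 1 tens_scale.
Proof.
elim/tensW=> s; rewrite pi_scale; congr \pi_tensor.
by rewrite -[RHS]map_id; apply: eq_map => -[x y] /=; rewrite scale1r.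
Qed.

Lemma tens_scaleDr : right_distributive tens_scale +%R.
Proof.
move=> a; elim/tensW=> s; elim/tensW=> t.
by rewrite /+%R /= !(pi_add, pi_scale) /tens_scaleseq map_cat.
Qed.

Lemma tens_scaleDl v : {morph tens_scale^~ v : a b / a + b}.
Proof.
elim/tensW: v => s a b; rewrite [in RHS]/+%R /= !(pi_add, pi_scale).
apply/tens_eqP; elim: s => [|[x y] s IHs]; first exact: tens_refl.
rewrite /= -cat1s -(cat1s _ (tens_scaleseq b s)).
apply: (@tens_trans _ (([:: (a *: x, y)] ++ [:: (b *: x, y)])
                       ++ (tens_scaleseq a s ++ tens_scaleseq b s))).
  by apply: tens_cat => //; rewrite scalerDl; apply: tens_Dl.
rewrite -catA -(cat1s _ (_ ++ _)); apply: tens_cat; first exact: tens_refl.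
by rewrite !catA; apply: tens_cat; [apply: tens_comm | apply: tens_refl].
Qed.

HB.instance Definition _ := GRing.Zmodule_isLmodule.Build R tensor
  tens_scaleA tens_scale1 tens_scaleDr tens_scaleDl.

Definition tens (x : M) (y : N) : tensor := \pi_tensor [:: (x, y)].

Lemma pi_tensE s : \pi_tensor s = \sum_(p <- s) tens p.1 p.2.
Proof.
elim: s => [|[x y] s IHs]; first by rewrite big_nil.
by rewrite big_cons -IHs -cat1s; symmetry; apply: pi_add.
Qed.

Lemma tensDl x x' y : tens (x + x') y = tens x y + tens x' y.
Proof.
by rewrite /tens [RHS]pi_add; apply/tens_eqP; apply: tens_Dl.
Qed.

Lemma tensDr x y y' : tens x (y + y') = tens x y + tens x y'.
Proof.
by rewrite /tens [RHS]pi_add; apply/tens_eqP; apply: tens_Dr.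
Qed.

Lemma tensZl a x y : tens (a *: x) y = a *: tens x y.
Proof. by symmetry; apply: pi_scale. Qed.

Lemma tensZr a x y : tens x (a *: y) = a *: tens x y.
Proof. by rewrite -tensZl; symmetry; apply/tens_eqP/tens_balanced. Qed.

Section Lift.
Variables (P : lmodType R) (b : M -> N -> P).
Hypothesis bl : forall y, linear (b^~ y).
Hypothesis br : forall x, linear (b x).

Definition tens_lift (u : tensor) : P := \sum_(p <- repr u) b p.1 p.2.

Let b0l y : b 0 y = 0.
Proof. by have := bl y (-1) 0 0; rewrite scaler0 addr0 scaleN1r addNr. Qed.
Let bDl x x' y : b (x + x') y = b x y + b x' y.
Proof. by have := bl y 1 x x'; rewrite !scale1r. Qed.
Let bZl a x y : b (a *: x) y = a *: b x y.
Proof. by have := bl y a x 0; rewrite b0l !addr0. Qed.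
Let b0r x : b x 0 = 0.
Proof. by have := br x (-1) 0 0; rewrite scaler0 addr0 scaleN1r addNr. Qed.
Let bDr x y y' : b x (y + y') = b x y + b x y'.
Proof. by have := br x 1 y y'; rewrite !scale1r. Qed.
Let bZr a x y : b x (a *: y) = a *: b x y.
Proof. by have := br x a y 0; rewrite b0r !addr0. Qed.

Lemma tens_rel_lift s t : tens_rel s t ->
  \sum_(p <- s) b p.1 p.2 = \sum_(p <- t) b p.1 p.2.
Proof.
elim=> {s t} [//|//|s t u _ -> //|s s' t t' _ h _ k|s t|y|x x' y|x y y'|a x y].
- by rewrite !big_cat /= h k.
- by rewrite !big_cat /= addrC.
- by rewrite big_cons big_nil addr0 b0l.
- by rewrite !big_cons big_nil !addr0 bDl.
- by rewrite !big_cons big_nil !addr0 bDr.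
- by rewrite !big_cons !big_nil !addr0 bZl bZr.
Qed.

Lemma tens_lift_pi s : tens_lift (\pi_tensor s) = \sum_(p <- s) b p.1 p.2.
Proof. exact/tens_rel_lift/tens_repr. Qed.

Lemma tens_liftE x y : tens_lift (tens x y) = b x y.
Proof. by rewrite tens_lift_pi big_cons big_nil addr0. Qed.

Lemma tens_lift_linear : linear tens_lift.
Proof.
move=> a; elim/tensW=> s; elim/tensW=> t.
rewrite [a *: _]pi_scale [_ + _]pi_add !tens_lift_pi big_cat big_map /=.
by congr (_ + _); rewrite scaler_sumr; apply: eq_bigr => p _; rewrite bZl.
Qed.

Lemma tens_lift_uniq (g : {linear tensor -> P}) :
  (forall x y, g (tens x y) = b x y) -> g =1 tens_lift.
Proof.
move=> gE; elim/tensW=> s; rewrite tens_lift_pi pi_tensE linear_sum.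
by apply: eq_bigr => p _.
Qed.

End Lift.
End Tensor.

Section Modules.
Variable R : comPzRingType.
Implicit Types (M N P F G Q : lmodType R).

Definition surjective (A B : Type) (f : A -> B) := forall y, exists x, f x = y.

(* f (x) F, mapping x (x) y to f x (x) y. *)
Definition tens_map M N F (f : {linear M -> N}) : tensor M F -> tensor N F :=
  tens_lift (fun x y => tens (f x) y).

Lemma tens_mapE M N F (f : {linear M -> N}) x y :
  @tens_map M N F f (tens x y) = tens (f x) y.
Proof.
apply: tens_liftE => [z a u v | z a u v].
  by rewrite linearP tensDl tensZl.
by rewrite tensDr tensZr.
Qed.

Lemma tens_map_linear M N F (f : {linear M -> N}) : linear (@tens_map M N F f).
Proof.
apply: tens_lift_linear => [z a u v | z a u v].
  by rewrite linearP tensDl tensZl.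
by rewrite tensDr tensZr.
Qed.

Definition flat F := forall M N (f : {linear M -> N}),
  injective f -> injective (@tens_map M N F f).

Definition projective P :=
  forall M N (g : {linear M -> N}) (f : {linear P -> N}),
    surjective g -> exists h : {linear P -> M}, forall x, g (h x) = f x.

(* There is an exact sequence 0 -> P_d -> ... -> P_0 -> M -> 0 with every P_i
   projective, written as an infinite resolution with P_i = 0 for i > d. *)
Definition pdim_le (d : nat) M :=
  exists (P : nat -> lmodType R) (e : {linear P 0%N -> M})
         (f : forall i, {linear P i.+1 -> P i}),
    [/\ forall i, projective (P i),
        forall i, (d < i)%N -> forall x : P i, x = 0,
        surjective e,
        forall x, e x = 0 <-> exists y, f 0%N y = x
      & forall i x, f i x = 0 <-> exists y, f i.+1 y = x].

Definition finitely_generated M :=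
  exists (n : nat) (p : {linear 'rV[R]_n -> M}), surjective p.

Definition finitely_presented M :=
  exists (m n : nat) (r : {linear 'rV[R]_m -> 'rV[R]_n})
         (p : {linear 'rV[R]_n -> M}),
    surjective p /\ forall x, p x = 0 <-> exists y, r y = x.

(* Chain complexes P_. indexed by int; [diff n] is P_(n+1) -> P_n. *)
Record complex := Complex {
  obj :> int -> lmodType R;
  diff : forall n : int, {linear obj (n + 1) -> obj n};
  diffK : forall n x, diff n (diff (n + 1) x) = 0 }.

Definition acyclic (P : complex) :=
  forall (n : int) (x : P (n + 1)),
    diff P n x = 0 -> exists y, diff P (n + 1) y = x.

(* Exactness of the complex of abelian groups Hom_R(P_., Q), whose differentials
   Hom_R(P_n, Q) -> Hom_R(P_(n+1), Q) are precomposition with [diff P n]. *)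
Definition hom_acyclic (P : complex) Q :=
  forall (n : int) (f : {linear P (n + 1) -> Q}),
    (forall x, f (diff P (n + 1) x) = 0) ->
    exists g : {linear P n -> Q}, forall x, f x = g (diff P n x).

Definition totally_acyclic (P : complex) :=
  [/\ forall n, projective (P n), acyclic P
    & forall Q, projective Q -> hom_acyclic P Q].

(* G is isomorphic, via [i], to the kernel of P_(n+1) -> P_n. *)
Definition iso_cycle G (P : complex) (n : int) :=
  exists i : {linear G -> P (n + 1)},
    injective i /\ forall x, diff P n x = 0 <-> exists y, i y = x.

Definition gorenstein_projective G :=
  exists (P : complex) (n : int), totally_acyclic P /\ iso_cycle G P n.

Definition gorenstein_projective_precover M G (phi : {linear G -> M}) :=
  gorenstein_projective G /\
  forall G' (f : {linear G' -> M}), gorenstein_projective G' ->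
    exists h : {linear G' -> G}, forall x, phi (h x) = f x.

End Modules.

Definition perfect (d : nat) (R : comPzRingType) :=
  forall F : lmodType R, flat F -> pdim_le d F.

(* Every finitely generated ideal is finitely presented, an ideal being given
   as a module I with an injective linear map to R. *)
Definition coherent (R : comPzRingType) :=
  forall (I : lmodType R) (i : {linear I -> R^o}),
    injective i -> finitely_generated I -> finitely_presented I.

(* Main.v *)
From HB Require Import structures.
Require Import Defs.
From mathcomp Require Import all_boot all_order all_algebra.
From mathcomp Require Import boolp.
From mathcomp Require classical_sets.
From mathcomp Require Import zify.

Set Implicit Arguments.
Unset Strict Implicit.
Unset Printing Implicit Defensive.

Import GRing.Theory Num.Theory.
Local Open Scope ring_scope.

(* Every Gorenstein projective module is a retract of a module [A] with a short
   exact sequence [A -> Q -> A], [Q] projective, for which maps from [A] to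
   projectives extend to [Q] (sum the complex over all degrees).  Given such an
   [A] and [f : A -> M], a maximal submodule [S] of [Q] on which all the relevant
   equations can be solved and on which [f] vanishes yields a quotient sequence
   [X -> F -> X] with [F] flat through which [f] factors.  By maximality [X] has
   bounded size: two isomorphic copies over [M] of a small elementary piece of
   [F] would produce a further submodule of differences.  As [F] has projective
   dimension at most [d], a [d]-th syzygy of [X] is Gorenstein projective (over a
   coherent ring the bidual of a flat module is flat and pure-injective, so that
   flat modules have finite coresolutions by such modules), and from it one
   obtains a Gorenstein projective module [G_X] mapping onto [X] with a kernel
   orthogonal to all Gorenstein projectives.  The direct sum of the [G_X], over a
   set of representatives of the maps [X -> M], is the precover. *)

(** * Linear algebra *)

(** Orthogonality of [A] to projectives is not visibly inherited by a quotient sequence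
    [X -> F -> X], whereas orthogonality to flat modules of the form [dual E N] is: the kernel of
    [A -> X] is pure in [A], and maps from a pure submodule to a dual module extend. Coherence
    serves to recover the projectives: it embeds each flat module in a flat dual with flat cokernel,
    and after [d] such steps the embedding splits because flat modules have projective dimension at
    most [d]. The middle term [F] is a pure quotient of a projective, hence only flat; here
    perfectness intervenes again, through an induction on the projective dimension of [F]. Sequences
    of period one make all Ext^n(A, -) with n >= 1 isomorphic, so that the single condition [hext]
    replaces total acyclicity. Boundedness needs no cardinal arithmetic: [code M] is a type built
    from [R] and [M] alone, a module covered by it is determined up to isomorphism by its relations
    among codes, and the possible sets of relations form a type over which a direct sum can be
    taken. *)

Section LinearMaps.
Variable R : comPzRingType.
Implicit Types A B C M N : lmodType R.

Definition mklin A B (f : A -> B) (hf : linear f) : {linear A -> B} :=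
  HB.pack f (GRing.isLinear.Build R A B *:%R f hf).

Lemma lin_scale A B (f : {linear A -> B}) a x : f (a *: x) = a *: f x.
Proof. exact: linearZ. Qed.

Definition submod M (S : M -> Prop) :=
  S 0 /\ forall a x y, S x -> S y -> S (a *: x + y).

(** The graph of a linear map defined on some submodule of [A]. Partial maps in this form need no
    name for their domain, which suits Zorn's lemma and definitions on representatives. *)
Definition linrel A B (G : A -> B -> Prop) :=
  [/\ G 0 0, forall a x y x' y', G x y -> G x' y' -> G (a *: x + x') (a *: y + y')
    & forall y, G 0 y -> y = 0].

Lemma linrel_fun A B (G : A -> B -> Prop) : linrel G ->
  forall x y y', G x y -> G x y' -> y = y'.
Proof.
case=> _ G2 G3 x y y' h h'; have := G2 (-1) _ _ _ _ h h'.
by rewrite !scaleN1r addNr => /G3/eqP; rewrite addrC subr_eq0 => /eqP.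
Qed.

Lemma lin_of_rel A B (G : A -> B -> Prop) : linrel G ->
  (forall x, exists y, G x y) -> exists h : {linear A -> B}, forall x, G x (h x).
Proof.
move=> hG tot; have [f fP] := choice tot.
have fl : linear f.
  move=> a x y; apply: (linrel_fun hG (fP _)).
  by case: hG => _ G2 _; apply: G2.
by exists (mklin fl).
Qed.

Lemma lker0 A B (f : {linear A -> B}) :
  (forall x, f x = 0 -> x = 0) -> injective f.
Proof.
move=> h x y e; apply/eqP; rewrite -subr_eq0; apply/eqP/h.
by rewrite linearB e subrr.
Qed.

Lemma submod0 M (S : M -> Prop) : submod S -> S 0. Proof. by case. Qed.
Lemma submodZ M (S : M -> Prop) a x : submod S -> S x -> S (a *: x).
Proof. by case=> h0 h hx; rewrite -[_ *: _]addr0; apply: h. Qed.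
Lemma submodD M (S : M -> Prop) x y : submod S -> S x -> S y -> S (x + y).
Proof. by case=> h0 h hx hy; rewrite -[x]scale1r; apply: h. Qed.
Lemma submodB M (S : M -> Prop) x y : submod S -> S x -> S y -> S (x - y).
Proof. by case=> h0 h hx hy; rewrite addrC -scaleN1r; apply: h. Qed.
Lemma submodN M (S : M -> Prop) x : submod S -> S x -> S (- x).
Proof. by move=> h hx; rewrite -scaleN1r; apply: submodZ. Qed.

End LinearMaps.

Section ProductModule.
Variables (R : comPzRingType) (J : Type) (M : J -> lmodType R).

Definition prodm : Type := forall j, M j.
HB.instance Definition _ := gen_eqMixin prodm.
HB.instance Definition _ := gen_choiceMixin prodm.

Let padd (f g : prodm) : prodm := fun j => f j + g j.
Let popp (f : prodm) : prodm := fun j => - f j.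
Let pzero : prodm := fun j => 0.
Let pscale (a : R) (f : prodm) : prodm := fun j => a *: f j.

Lemma paddA : associative padd.
Proof. by move=> f g h; apply: functional_extensionality_dep => j; apply: addrA. Qed.
Lemma paddC : commutative padd.
Proof. by move=> f g; apply: functional_extensionality_dep => j; apply: addrC. Qed.
Lemma padd0 : left_id pzero padd.
Proof. by move=> f; apply: functional_extensionality_dep => j; apply: add0r. Qed.
Lemma paddN : left_inverse pzero popp padd.
Proof. by move=> f; apply: functional_extensionality_dep => j; apply: addNr. Qed.
HB.instance Definition _ := GRing.isZmodule.Build prodm paddA paddC padd0 paddN.

Lemma pscaleA a b v : pscale a (pscale b v) = pscale (a * b) v.
Proof. by apply: functional_extensionality_dep => j; apply: scalerA. Qed.
Lemma pscale1 : left_id 1 pscale.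
Proof. by move=> f; apply: functional_extensionality_dep => j; apply: scale1r. Qed.
Lemma pscaleDr : right_distributive pscale +%R.
Proof. by move=> a f g; apply: functional_extensionality_dep => j; apply: scalerDr. Qed.
Lemma pscaleDl v : {morph pscale^~ v : a b / a + b}.
Proof. by move=> a b; apply: functional_extensionality_dep => j; apply: scalerDl. Qed.
HB.instance Definition _ := GRing.Zmodule_isLmodule.Build R prodm
  pscaleA pscale1 pscaleDr pscaleDl.

Lemma prodmD (f g : prodm) j : (f + g) j = f j + g j. Proof. by []. Qed.
Lemma prodmZ a (f : prodm) j : (a *: f) j = a *: f j. Proof. by []. Qed.
Lemma prodm0 j : (0 : prodm) j = 0. Proof. by []. Qed.
Lemma prodm_sum I (r : seq I) P (F : I -> prodm) j :
  (\sum_(i <- r | P i) F i) j = \sum_(i <- r | P i) F i j.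
Proof. by elim/big_rec2: _ => // i y z _ <-. Qed.

End ProductModule.

Section Submodule.
Variables (R : comPzRingType) (M : lmodType R).

Record submodule := Submodule { car :> M -> Prop; carP : submod car }.

Definition submem (S : submodule) : {pred M} := fun x => `[< S x >].

Lemma submemP (S : submodule) x : reflect (S x) (x \in submem S).
Proof. exact: asboolP. Qed.

Lemma submem_closed S : submod_closed (submem S).
Proof.
split; first by apply/submemP; apply: submod0 (carP S).
move=> a x y /submemP hx /submemP hy; apply/submemP.
by case: (carP S) => _; apply.
Qed.
HB.instance Definition _ S :=
  GRing.isSubmodClosed.Build R M (submem S) (submem_closed S).

Definition subm (S : submodule) := {x : M | x \in submem S}.
HB.instance Definition _ S := Choice.on (subm S).
HB.instance Definition _ S := SubType.on (subm S).
HB.instance Definition _ S := [SubChoice_isSubLmodule of subm S by <:].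

Lemma sub_ex (S : M -> Prop) : submod S ->
  exists (K : lmodType R) (i : {linear K -> M}),
    injective i /\ forall x, S x <-> exists y, i y = x.
Proof.
move=> hS; pose T := Submodule hS.
have vl : linear (val : subm T -> M) by move=> a x y; rewrite linearP.
exists (subm T), (mklin vl); split; first exact: val_inj.
move=> x; split=> [Sx|[y <-]]; last by have /submemP := valP y.
have Sx' : x \in submem T by apply/submemP.
by exists (exist _ x Sx').
Qed.

End Submodule.

Section Quotient.
Variables (R : comPzRingType) (M : lmodType R) (S : submodule M).

(** Congruent elements give extensionally equal predicates, and [choose] then returns the same
    element: this is a canonical representative of the coset. *)
Definition qrep (x : M) : M := choose (fun y => `[< S (y - x) >]) x.

Lemma qrepP x : S (qrep x - x).
Proof.
apply/asboolP/(@chooseP _ (fun y => `[< S (y - x) >])).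
by apply/asboolP; rewrite subrr; apply: submod0 (carP S).
Qed.

Lemma qrep_eq x y : S (x - y) -> qrep x = qrep y.
Proof.
move=> h; rewrite /qrep.
have e : (fun z => `[< S (z - x) >]) =1 (fun z => `[< S (z - y) >]).
  move=> z; apply/asboolP/asboolP => k.
    by rewrite -(subrK x z) -addrA; apply: submodD (carP S) k h.
  rewrite -(subrK y z) -addrA; apply: submodD (carP S) k _.
  by rewrite -opprB; apply: submodN (carP S) h.
rewrite (eq_choose e); apply: choose_id; apply/asboolP; first by [].
by rewrite subrr; apply: submod0 (carP S).
Qed.

Lemma qrep_eqP x y : qrep x = qrep y <-> S (x - y).
Proof.
split; last exact: qrep_eq.
move=> e; have hx := qrepP x; have hy := qrepP y; rewrite e in hx.
have := submodB (carP S) hy hx.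
by rewrite opprB addrC addrA subrK.
Qed.

Lemma qrepK x : qrep (qrep x) = qrep x.
Proof. exact/qrep_eqP/qrepP. Qed.

Definition quotm := {x : M | qrep x == x}.
HB.instance Definition _ := Choice.on quotm.

Lemma quotm_inj (u v : quotm) : sval u = sval v -> u = v.
Proof. by case: u v => [x hx] [y hy] /= e; subst y; congr exist; apply: bool_irrelevance. Qed.

Definition qpi x : quotm := exist _ (qrep x) (introT eqP (qrepK x)).

Lemma qpi_eq x y : S (x - y) -> qpi x = qpi y.
Proof. by move=> h; apply: quotm_inj; apply: qrep_eq. Qed.

Lemma qpi_val u : qpi (sval u) = u.
Proof. by apply: quotm_inj; apply/eqP/(svalP u). Qed.

Lemma qpi_valK x : S (sval (qpi x) - x). Proof. exact: qrepP. Qed.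

Let qadd (u v : quotm) : quotm := qpi (sval u + sval v).
Let qopp (u : quotm) : quotm := qpi (- sval u).
Let qscale (a : R) (u : quotm) : quotm := qpi (a *: sval u).

Lemma qaddE x y : qadd (qpi x) (qpi y) = qpi (x + y).
Proof.
apply: qpi_eq; rewrite opprD addrACA.
by apply: submodD (carP S) _ _; apply: qpi_valK.
Qed.
Lemma qoppE x : qopp (qpi x) = qpi (- x).
Proof.
by apply: qpi_eq; rewrite -opprD; apply: submodN (carP S) _; apply: qpi_valK.
Qed.
Lemma qscaleE a x : qscale a (qpi x) = qpi (a *: x).
Proof.
by apply: qpi_eq; rewrite -scalerBr; apply: submodZ (carP S) _; apply: qpi_valK.
Qed.
Lemma qpi_ind (P : quotm -> Prop) : (forall x, P (qpi x)) -> forall u, P u.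
Proof. by move=> h u; rewrite -(qpi_val u). Qed.

Lemma qaddA : associative qadd.
Proof. by elim/qpi_ind=> x; elim/qpi_ind=> y; elim/qpi_ind=> z; rewrite !qaddE addrA. Qed.
Lemma qaddC : commutative qadd.
Proof. by elim/qpi_ind=> x; elim/qpi_ind=> y; rewrite !qaddE addrC. Qed.
Lemma qadd0 : left_id (qpi 0) qadd.
Proof. by elim/qpi_ind=> x; rewrite qaddE add0r. Qed.
Lemma qaddN : left_inverse (qpi 0) qopp qadd.
Proof. by elim/qpi_ind=> x; rewrite qoppE qaddE addNr. Qed.
HB.instance Definition _ := GRing.isZmodule.Build quotm qaddA qaddC qadd0 qaddN.

Lemma qscaleA a b v : qscale a (qscale b v) = qscale (a * b) v.
Proof. by elim/qpi_ind: v => x; rewrite !qscaleE scalerA. Qed.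
Lemma qscale1 : left_id 1 qscale.
Proof. by elim/qpi_ind=> x; rewrite qscaleE scale1r. Qed.
Lemma qscaleDr : right_distributive qscale +%R.
Proof.
move=> a; elim/qpi_ind=> x; elim/qpi_ind=> y.
by rewrite [_ + _]qaddE !qscaleE [RHS]qaddE scalerDr.
Qed.
Lemma qscaleDl v : {morph qscale^~ v : a b / a + b}.
Proof.
move=> a b; elim/qpi_ind: v => x.
by rewrite !qscaleE [RHS]qaddE scalerDl.
Qed.
HB.instance Definition _ := GRing.Zmodule_isLmodule.Build R quotm
  qscaleA qscale1 qscaleDr qscaleDl.

Lemma qpi_linear : linear qpi.
Proof. by move=> a x y; rewrite [a *: qpi x]qscaleE [RHS]qaddE. Qed.

End Quotient.

Lemma quot_ex (R : comPzRingType) (M : lmodType R) (S : M -> Prop) :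
  submod S -> exists (N : lmodType R) (p : {linear M -> N}),
    surjective p /\ forall x, p x = 0 <-> S x.
Proof.
move=> hS; pose T := Submodule hS.
exists (quotm T), (mklin (@qpi_linear _ _ T)); split.
  by move=> u; exists (sval u); apply: qpi_val.
move=> x; split=> [/(congr1 sval)|h].
  by rewrite /= => /qrep_eqP; rewrite subr0.
by apply: qpi_eq; rewrite subr0.
Qed.

(** * Exact sequences, direct sums and projective modules *)

Section Exactness.
Variable R : comPzRingType.
Implicit Types A B C K M N P : lmodType R.

Definition ses A B C (i : {linear A -> B}) (p : {linear B -> C}) :=
  [/\ injective i, surjective p & forall x, p x = 0 <-> exists y, i y = x].

Lemma ses0 A B C (i : {linear A -> B}) (p : {linear B -> C}) y :
  ses i p -> p (i y) = 0.
Proof. by case=> _ _ h; apply/h; exists y. Qed.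

Lemma ker_submod A B (p : {linear A -> B}) : submod (fun x => p x = 0).
Proof.
split; first exact: linear0.
by move=> a x y hx hy; rewrite linearP hx hy scaler0 addr0.
Qed.

Lemma im_submod A B (i : {linear A -> B}) : submod (fun x => exists y, i y = x).
Proof.
split; first by exists 0; rewrite linear0.
by move=> a _ _ [x <-] [y <-]; exists (a *: x + y); rewrite linearP.
Qed.

Lemma ker_ex B C (p : {linear B -> C}) : surjective p ->
  exists (K : lmodType R) (i : {linear K -> B}), ses i p.
Proof.
move=> sp; have [K [i [ii hi]]] := sub_ex (ker_submod p).
by exists K, i.
Qed.

Lemma coker_ex A B (i : {linear A -> B}) : injective i ->
  exists (C : lmodType R) (p : {linear B -> C}), ses i p.
Proof.
move=> ii; have [K [p [sp hp]]] := quot_ex (im_submod i).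
by exists K, p.
Qed.

Lemma factor_surj B C N (p : {linear B -> C}) (f : {linear B -> N}) :
  surjective p -> (forall x, p x = 0 -> f x = 0) ->
  exists g : {linear C -> N}, forall x, g (p x) = f x.
Proof.
move=> sp h; pose G c n := exists x, p x = c /\ f x = n.
have [] := @lin_of_rel _ _ _ G.
- split; first by exists 0; rewrite !linear0.
    move=> a _ _ _ _ [x [<- <-]] [y [<- <-]].
    by exists (a *: x + y); rewrite !linearP.
  by move=> y [x [/h e <-]].
- by move=> c; have [x <-] := sp c; exists (f x), x.
move=> g hg; exists g => x.
have [y [e <-]] := hg (p x); apply/eqP; rewrite -subr_eq0 -linearB; apply/eqP/h.
by rewrite linearB e subrr.
Qed.

Lemma factor_ses A B C N (i : {linear A -> B}) (p : {linear B -> C})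
    (f : {linear B -> N}) : ses i p -> (forall y, f (i y) = 0) ->
  exists g : {linear C -> N}, forall x, g (p x) = f x.
Proof.
move=> [_ sp h] hf; apply: factor_surj => // x /h[y <-]; exact: hf.
Qed.

Lemma factor_inj A B N (i : {linear A -> B}) (f : {linear N -> B}) :
  injective i -> (forall n, exists y, i y = f n) ->
  exists g : {linear N -> A}, forall n, i (g n) = f n.
Proof.
move=> ii h; apply: (@lin_of_rel _ _ _ (fun n y => i y = f n)) => //.
split; first by rewrite !linear0.
  by move=> a x y x' y' e e'; rewrite !linearP e e'.
by move=> y; rewrite linear0 -{1}(linear0 i) => /ii.
Qed.

Definition lfst A B : {linear (A * B)%type -> A} := fst.
Definition lsnd A B : {linear (A * B)%type -> B} := snd.

Lemma lpair_linear A B N (f : {linear N -> A}) (g : {linear N -> B}) :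
  linear (fun x => (f x, g x)).
Proof. by move=> a x y; rewrite !linearP. Qed.
Definition lpair A B N (f : {linear N -> A}) (g : {linear N -> B}) :
  {linear N -> (A * B)%type} := mklin (lpair_linear f g).

Lemma lcopair_linear A B N (f : {linear A -> N}) (g : {linear B -> N}) :
  linear (fun x : A * B => f x.1 + g x.2).
Proof.
by move=> a x y; rewrite !linearP /= scalerDr addrACA.
Qed.
Definition lcopair A B N (f : {linear A -> N}) (g : {linear B -> N}) :
  {linear (A * B)%type -> N} := mklin (lcopair_linear f g).

Lemma lscal_linear M (m : M) : linear (fun r : R^o => r *: m).
Proof. by move=> a x y; rewrite scalerDl scalerA. Qed.
Definition lscal M (m : M) : {linear R^o -> M} := mklin (lscal_linear m).

Definition lzero A B : {linear A -> B} := \0.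
Definition lid A : {linear A -> A} := idfun.
Definition lcomp A B C (g : {linear B -> C}) (f : {linear A -> B}) :
  {linear A -> C} := g \o f.
Lemma lsub_linear A B (f g : {linear A -> B}) : linear (fun x => f x - g x).
Proof.
by move=> a x y; rewrite !linearP addrACA -scalerDr.
Qed.
Definition lsub A B (f g : {linear A -> B}) : {linear A -> B} :=
  mklin (lsub_linear f g).

End Exactness.

Lemma dep_choice (J : Type) (T : J -> Type) (P : forall j, T j -> Prop) :
  (forall j, exists x, P j x) -> exists f : forall j, T j, forall j, P j (f j).
Proof.
move=> h; exists (fun j => projT1 (cid (h j))) => j.
exact: (projT2 (cid (h j))).
Qed.

Section DirectSum.
Variables (R : comPzRingType) (J : Type) (M : J -> lmodType R).

Definition fin_supp (f : prodm M) :=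
  exists s : seq {classic J}, forall j : {classic J}, j \notin s -> f j = 0.

Lemma fin_supp_submod : submod fin_supp.
Proof.
split; first by exists [::].
move=> a x y [s hs] [t ht]; exists (s ++ t) => j.
by rewrite mem_cat negb_or => /andP[js jt]; rewrite prodmD prodmZ hs // ht // scaler0 addr0.
Qed.

Definition single j (x : M j) : prodm M := fun k =>
  match pselect (j = k) with left e => ecast k (M k) e x | right _ => 0 end.

Lemma singleE j (x : M j) : single x j = x.
Proof.
rewrite /single; case: pselect => // e.
by rewrite (Prop_irrelevance e erefl).
Qed.

Lemma singleN j k (x : M j) : j <> k -> single x k = 0.
Proof. by rewrite /single; case: pselect. Qed.

Lemma single_linear j : linear (@single j).
Proof.
move=> a x y; apply: functional_extensionality_dep => k.
rewrite [RHS]prodmD prodmZ; have [e|n] := pselect (j = k); last first.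
  by rewrite !singleN // scaler0 addr0.
by subst k; rewrite !singleE.
Qed.

Lemma dsum_ex : exists (D : lmodType R) (inc : forall j, {linear M j -> D})
   (pr : forall j, {linear D -> M j}),
  [/\ forall j x, pr j (inc j x) = x,
      forall j k x, j <> k -> pr k (inc j x) = 0,
      forall u v, (forall j, pr j u = pr j v) -> u = v &
      forall u, exists2 s : seq {classic J}, uniq s &
         (forall j : {classic J}, j \notin s -> pr j u = 0)
         /\ u = \sum_(j <- s) inc j (pr j u)].
Proof.
have [D [v [vi vP]]] := sub_ex fin_supp_submod.
have hinc j : exists h : {linear M j -> D}, forall x, v (h x) = single x.
  apply: (@factor_inj _ _ _ _ v (mklin (@single_linear j)) vi) => x.
  apply/vP; exists [:: (j : {classic J})] => k; rewrite inE => /eqP jk.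
  by apply: singleN => e; apply: jk.
have [inc incP] := dep_choice hinc.
have prl j : linear (fun u => v u j) by move=> a x y; rewrite linearP.
exists D, inc, (fun j => mklin (prl j)).
have ext u w : (forall j, v u j = v w j) -> u = w.
  by move=> e; apply: vi; apply: functional_extensionality_dep.
split => //=.
- by move=> j x; rewrite incP singleE.
- by move=> j k x jk; rewrite incP singleN.
move=> u; have [|s hs] := (vP (v u)).2; first by exists u.
exists (undup s); rewrite ?undup_uniq //; split.
  by move=> j; rewrite mem_undup => /hs.
apply: ext => k; rewrite linear_sum prodm_sum.
have [ks|ks] := boolP ((k : {classic J}) \in undup s).
  rewrite (bigD1_seq (k : {classic J})) ?undup_uniq //= incP singleE big1 ?addr0 //.
  by move=> j /eqP jk; rewrite incP singleN.
rewrite big_seq big1; first by apply: hs; rewrite -mem_undup.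
by move=> j js; rewrite incP singleN // => e; rewrite -e js in ks.
Qed.

End DirectSum.

Section DsumProps.
Variables (R : comPzRingType) (J : Type) (M : J -> lmodType R).
Variables (D : lmodType R) (inc : forall j, {linear M j -> D})
   (pr : forall j, {linear D -> M j}).
Hypothesis prK : forall j x, pr j (inc j x) = x.
Hypothesis pr0 : forall j k x, j <> k -> pr k (inc j x) = 0.
Hypothesis dec : forall u, exists2 s : seq {classic J}, uniq s &
         (forall j : {classic J}, j \notin s -> pr j u = 0)
         /\ u = \sum_(j <- s) inc j (pr j u).

Lemma sum_support (N : lmodType R) (F : J -> N) (s t : seq {classic J}) :
  uniq s -> uniq t -> {subset s <= t} -> (forall j : {classic J}, j \notin s -> F j = 0) ->
  \sum_(j <- s) F j = \sum_(j <- t) F j.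
Proof.
move=> us ut st h; rewrite [RHS](bigID (fun j => j \in s)) /= [X in _ + X]big1 => [|j]; last first.
  exact: h.
rewrite addr0 -[RHS]big_filter; apply: perm_big; apply: uniq_perm => //.
  exact: filter_uniq.
by move=> j; rewrite mem_filter; case js: (j \in s) => //=; rewrite st.
Qed.

Lemma dsum_lift (N : lmodType R) (h : forall j, {linear M j -> N}) :
  exists H : {linear D -> N}, forall j x, H (inc j x) = h j x.
Proof.
pose G u y := exists s : seq {classic J}, [/\ uniq s,
  forall j : {classic J}, j \notin s -> pr j u = 0 & y = \sum_(j <- s) h j (pr j u)].
have [] := @lin_of_rel _ _ _ G.
- split; first by exists [::]; split=> // [j _|]; rewrite ?linear0 // big_nil.
    move=> a x y x' y' [s [us hs ->]] [t [ut ht ->]].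
    exists (undup (s ++ t)); rewrite undup_uniq; split=> // [j|].
      rewrite mem_undup mem_cat negb_or => /andP[js jt].
      by rewrite linearP hs // ht // scaler0 addr0.
    rewrite (@sum_support _ _ s (undup (s ++ t))) ?undup_uniq //; first last.
    - by move=> j js; rewrite hs // linear0.
    - by move=> j js; rewrite mem_undup mem_cat js.
    rewrite (@sum_support _ _ t (undup (s ++ t))) ?undup_uniq //; first last.
    - by move=> j js; rewrite ht // linear0.
    - by move=> j js; rewrite mem_undup mem_cat js orbT.
    rewrite scaler_sumr -big_split /=; apply: eq_bigr => j _.
    by rewrite !linearP.
  by move=> y [s [_ _ ->]]; rewrite big1 // => j _; rewrite !linear0.
- by move=> u; have [s us [hs _]] := dec u; exists (\sum_(j <- s) h j (pr j u)), s.
move=> H hH; exists H => j x; have [s [us hs ->]] := hH (inc j x).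
have [js|js] := boolP ((j : {classic J}) \in s).
  rewrite (bigD1_seq (j : {classic J})) //= prK big1 ?addr0 //.
  by move=> k kj; rewrite pr0 ?linear0 // => e; rewrite e eqxx in kj.
have := hs _ js; rewrite prK => ->; rewrite !linear0 big1 // => k _.
by rewrite !linear0.
Qed.

Lemma dsum_eq (N : lmodType R) (f g : {linear D -> N}) :
  (forall j x, f (inc j x) = g (inc j x)) -> forall u, f u = g u.
Proof.
move=> h u; have [s us [hs ->]] := dec u.
by rewrite !linear_sum; apply: eq_bigr => j _.
Qed.

Lemma dsum_projective : (forall j, projective (M j)) -> projective D.
Proof.
move=> h A B g f sg.
have [l lP] := dep_choice (fun j => h j _ _ g (lcomp f (inc j)) sg).
have [H HP] := dsum_lift l; exists H => u.
by apply: (@dsum_eq _ (lcomp g H)) => j x /=; rewrite HP lP.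
Qed.

End DsumProps.

Section Projective.
Variable R : comPzRingType.
Implicit Types A B C K M N P : lmodType R.

Lemma proj_regular : projective (R^o : lmodType R).
Proof.
move=> A B g f sg; have [m hm] := sg (f 1); exists (lscal m) => r /=.
by rewrite linearZ /= hm -linearZ /=; congr (f _); rewrite /GRing.scale /= mulr1.
Qed.

Definition retract M' M :=
  exists (i : {linear M' -> M}) (r : {linear M -> M'}), forall x, r (i x) = x.

Lemma retract_projective P P' : retract P' P -> projective P -> projective P'.
Proof.
move=> [i [r ri]] h A B g f sg; have [l lP] := h _ _ g (lcomp f r) sg.
by exists (lcomp l i) => x /=; rewrite lP /= ri.
Qed.

Lemma pair_projective P P' : projective P -> projective P' ->
  projective (P * P')%type.
Proof.
move=> h h' A B g f sg.
pose j1 : {linear P -> (P * P')%type} := lpair (lid P) (lzero P P').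
pose j2 : {linear P' -> (P * P')%type} := lpair (lzero P' P) (lid P').
have [l lP] := h _ _ g (lcomp f j1) sg.
have [l' lP'] := h' _ _ g (lcomp f j2) sg.
exists (lcopair l l') => -[x y] /=.
rewrite linearD lP lP' /= -linearD; congr (f _).
change ((x + 0, 0 + y) = (x, y)); by rewrite addr0 add0r.
Qed.

Lemma free_cover M : exists (D : lmodType R) (inc : M -> {linear R^o -> D})
   (pr : M -> {linear D -> R^o}) (p : {linear D -> M}),
  [/\ projective D, surjective p,
   (forall x r, p (inc x r) = r *: x) &
      forall u, exists2 s : seq {classic M}, uniq s &
         (forall j : {classic M}, j \notin s -> pr j u = 0)
         /\ u = \sum_(j <- s) inc j (pr j u)].
Proof.
have [D [inc [pr [h1 h2 h3 h4]]]] := dsum_ex (fun _ : M => R^o : lmodType R).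
have [p hp] := dsum_lift h1 h2 h4 (fun x => lscal x).
exists D, inc, pr, p; split => //.
  by apply: dsum_projective h1 h2 h4 _ => _; apply: proj_regular.
by move=> x; exists (inc x 1); rewrite hp /= scale1r.
Qed.

Lemma proj_cover M : exists (P : lmodType R) (p : {linear P -> M}),
  projective P /\ surjective p.
Proof. by have [D [_ [_ [p [h h' _ _]]]]] := free_cover M; exists D, p. Qed.

Lemma proj_ses M : exists (K P : lmodType R) (i : {linear K -> P})
  (p : {linear P -> M}), projective P /\ ses i p.
Proof.
have [P [p [hP sp]]] := proj_cover M; have [K [i hi]] := ker_ex sp.
by exists K, P, i, p.
Qed.

End Projective.

(** * Injective modules *)

(** Zorn's lemma is applied to the property [Q] of the union with [K], so that the empty chain
    yields [K] and only nonempty chains have to be handled by the user. *)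
Lemma zorn_above (T : Type) (K : T -> Prop) (Q : (T -> Prop) -> Prop) :
  Q K ->
  (forall F : (T -> Prop) -> Prop,
     (exists G, F G) -> (forall G, F G -> Q G) ->
     (forall G H, F G -> F H -> (forall x, G x -> H x) \/ (forall x, H x -> G x)) ->
     Q (fun x => exists2 G, F G & G x)) ->
  exists G : T -> Prop, [/\ forall x, K x -> G x, Q G &
    forall H : T -> Prop, Q H -> (forall x, G x -> H x) -> forall x, H x -> G x].
Proof.
move=> QK QU.
have [|G [QG maxG]] := @classical_sets.Zorn_bigcup T (fun G => Q (fun x => G x \/ K x)).
  move=> F FQ Ftot; have [[G0 FG0]|noF] := pselect (exists G, F G); last first.
    suff -> : (fun x => classical_sets.bigcup F (fun X => X) x \/ K x) = K by [].
    apply/funext => x; apply/propext; split; last by right.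
    by case=> // -[G FG _]; case: noF; exists G.
  pose F' H := exists2 G, F G & H = (fun x => G x \/ K x).
  have := QU F'; set A := (X in _ -> _ -> _ -> Q X); move=> h.
  suff -> : (fun x => classical_sets.bigcup F (fun X => X) x \/ K x) = A.
    apply: h; first by exists (fun x => G0 x \/ K x), G0.
      by move=> _ [G /FQ ? ->].
    move=> _ _ [G FG ->] [H FH ->].
    by have [h|h] := Ftot _ _ FG FH; [left|right] => x [/h|]; [left|right|left|right].
  apply/funext => x; apply/propext; split.
    case=> [[G FG Gx]|Kx]; first by exists (fun x => G x \/ K x); [exists G|left].
    by exists (fun x => G0 x \/ K x); [exists G0|right].
  by case=> _ [G FG ->] [Gx|Kx]; [left; exists G|right].
exists (fun x => G x \/ K x); split=> // [x Kx|H QH GH x Hx]; first by right.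
have [//|nGx] := pselect (G x \/ K x); case: (maxG H).
  split; first by move=> y Gy; apply: GH; left.
  by move=> HG; apply: nGx; left; apply: HG.
suff -> : (fun y => H y \/ K y) = H by [].
apply/funext => y; apply/propext; split; last by left.
by case=> // Ky; apply: GH; right.
Qed.

(** Injectivity tested on ideals: [I] is the graph of a linear map from an ideal to [E]. *)
Definition baer (R : comPzRingType) (E : lmodType R) :=
  forall I : R^o -> E -> Prop, linrel I ->
    exists e : E, forall (r : R^o) y, I r y -> y = r *: e.

Lemma baer_extend_relation (R : comPzRingType) (E N : lmodType R) (K : N -> E -> Prop) :
  baer E -> linrel K -> exists h : {linear N -> E}, forall n y, K n y -> y = h n.
Proof.
move=> bE hK; pose Q (G : N * E -> Prop) := linrel (fun n y => G (n, y)).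
have [||G [KG QG maxG]] := @zorn_above (N * E)%type (fun z => K z.1 z.2) Q.
- exact: hK.
- move=> F [G0 FG0] FQ Ftot; split; first by exists G0 => //; case: (FQ _ FG0).
    move=> a x y x' y' [G FG Gxy] [H FH Hxy].
    have [h|h] := Ftot _ _ FG FH.
      by exists H => //; case: (FQ _ FH) => _ c _; apply: c => //; apply: h.
    by exists G => //; case: (FQ _ FG) => _ c _; apply: c => //; apply: h.
  by move=> y [G FG Gy]; case: (FQ _ FG) => _ _; apply.
have tot x : exists y, G (x, y).
  have [G1 G2 G3] := QG.
  have [|e he] := bE (fun r y => G (r *: x, y)).
    split; first by rewrite scale0r.
      move=> a r y r' y' h h'; have := G2 a _ _ _ _ h h'.
      by rewrite scalerA -scalerDl.
    by move=> y; rewrite scale0r; apply: G3.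
  (* Baer's condition for the ideal of all [r] with [r *: x] in the domain provides [e]; adjoining
     [x] with value [e] is then consistent, and maximality puts [x] in the domain. *)
  exists e; apply: (maxG (fun z => exists n y (r : R),
    [/\ G (n, y), z.1 = n + r *: x & z.2 = y + r *: e])).
  - split=> /=; first by exists 0, 0, 0; rewrite !scale0r !addr0.
      move=> a _ _ _ _ [n [y [r [h -> ->]]]] [n' [y' [r' [h' -> ->]]]].
      exists (a *: n + n'), (a *: y + y'), (a * r + r'); split; first exact: G2.
        by rewrite scalerDr scalerA addrACA -scalerDl.
      by rewrite scalerDr scalerA addrACA -scalerDl.
    move=> _ [n [y [r [h e0 ->]]]].
    have e1 : n = - r *: x by apply/eqP; rewrite scaleNr -subr_eq0 opprK -e0.
    by rewrite e1 in h; rewrite (he _ _ h) scaleNr addNr.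
  - by move=> [n y] h; exists n, y, 0; rewrite /= !scale0r !addr0.
  by exists 0, 0, 1; rewrite /= !scale1r !add0r.
have [h hP] := lin_of_rel QG tot.
exists h => n y Kny; apply: (linrel_fun QG) (hP n).
exact: (KG (n, y)).
Qed.

(** * The injective abelian group of rationals modulo integers *)

Section RationalsModIntegers.

(** A nonzero ideal of the integers is generated by its least positive element [m.+1], so dividing
    the value there by [m.+1] gives the required element. *)
Lemma divisible_baer (U : lmodType int) :
  (forall (n : nat) (u : U), exists v, n.+1%:Z *: v = u) -> baer U.
Proof.
move=> dv I hI; have [I0 I2 I3] := hI.
have IZ (a : int) (r : int) y : I r y -> I (a * r) (a *: y).
  by move=> h; have := I2 a _ _ _ _ h I0; rewrite !addr0.
have [[n0 hn0]|no] := pselect (exists n : nat, exists y, I n.+1%:Z y); last first.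
  exists 0 => r y h; rewrite scaler0.
  suff r0 : r = 0 by apply: I3; rewrite r0 in h.
  case: r h => [[//|n]|n] h; first by case: no; exists n, y.
  by case: no; exists n, (- y); have := IZ (-1) _ _ h; rewrite scaleN1r NegzE mulN1r opprK.
pose P n := `[< exists y, I n.+1%:Z y >].
have exP : exists n, P n by exists n0; apply/asboolP.
case: (ex_minnP exP) => m /asboolP [y0 hy0] mmin.
have [e he] := dv m y0; exists e => r y h.
have dm : (m.+1%:Z %| r)%Z.
  rewrite /dvdz; have := divz_eq r m.+1%:Z; set q := (r %/ _)%Z; set s := (r %% _)%Z => er.
  have sI : I s (y - q *: y0).
    have := I2 (-1) _ _ _ _ (IZ q _ _ hy0) h.
    have -> : -1 *: (q * m.+1%:Z : int^o) + r = s.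
      by rewrite [-1 *: _]mulN1r {1}er addKr.
    by rewrite scaleN1r addrC.
  have s0 : 0 <= s by apply: modz_ge0.
  have sm : s < m.+1%:Z by rewrite /s -[X in _ < X]gez0_abs //; apply: ltz_mod.
  case: s => // -[|k] in er sI s0 sm *.
    by rewrite er addr0; apply/dvdzP; exists q.
  have /mmin : P k by apply/asboolP; eexists; apply: sI.
  by move=> mk; move: sm mk; lia.
have /dvdzP[q er] := dm.
have := linrel_fun hI (IZ q _ _ hy0); rewrite -er => /(_ _ h) <-.
by rewrite er -he scalerA.
Qed.

Lemma rat_mod_int : exists U : lmodType int,
  baer U /\ forall k : nat, exists u : U,
     u != 0 /\ k.+2%:Z *: u = 0.
Proof.
pose Q : lmodType int := zmodule rat.
have Sint : submod (fun x : Q => exists n : int, x = n%:~R :> rat).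
  split; first by exists 0.
  move=> a x y [n ->] [m ->]; exists (a * n + m).
  by rewrite intrD intrM mulrzl.
have [U [p [sp pP]]] := quot_ex Sint.
exists U; split.
  apply: divisible_baer => n u; have [x <-] := sp u.
  exists (p ((x : rat) / n.+1%:R : rat)); rewrite -linearZ /=; congr (p _).
  rewrite scalezrE -mulrzl -pmulrn mulrC divfK //.
  by rewrite pnatr_eq0.
move=> k; exists (p ((k.+2%:R : rat)^-1)); split.
  apply/eqP => /pP [n] hn.
  have : (k.+2%:Z * n)%:~R = 1%:~R :> rat.
    by rewrite intrM -hn -pmulrn mulfV // pnatr_eq0.
  by move/intr_inj => e; have [?|?] : n <= 0 \/ 1 <= n; [lia|nia|nia].
rewrite -linearZ /=; apply/pP; exists 1.
by rewrite scalezrE -mulrzl -pmulrn mulfV // pnatr_eq0.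
Qed.
End RationalsModIntegers.

(** * Character modules and an injective cogenerator *)

Section CharacterModule.
Variables (R : comPzRingType) (U : zmodType).

Definition charm : Type := {f : R -> U | forall x y, f (x + y) = f x + f y}.
HB.instance Definition _ := gen_eqMixin charm.
HB.instance Definition _ := gen_choiceMixin charm.

Lemma charm_eq (f g : charm) : (forall x, sval f x = sval g x) -> f = g.
Proof. by case: f g => [f hf] [g hg] /= /funext e; apply/eq_exist. Qed.

Let cadd (f g : charm) : charm.
Proof.
exists (fun x => sval f x + sval g x) => x y.
by rewrite (svalP f) (svalP g) addrACA.
Defined.
Let copp (f : charm) : charm.
Proof.
by exists (fun x => - sval f x) => x y; rewrite (svalP f) opprD.
Defined.
Let czero : charm.
Proof. by exists (fun x => 0) => x y; rewrite addr0. Defined.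
Let cscale (a : R) (f : charm) : charm.
Proof. by exists (fun x => sval f (x * a)) => x y; rewrite mulrDl (svalP f). Defined.

Lemma caddA : associative cadd.
Proof. by move=> f g h; apply: charm_eq => x /=; rewrite addrA. Qed.
Lemma caddC : commutative cadd.
Proof. by move=> f g; apply: charm_eq => x /=; rewrite addrC. Qed.
Lemma cadd0 : left_id czero cadd.
Proof. by move=> f; apply: charm_eq => x /=; rewrite add0r. Qed.
Lemma caddN : left_inverse czero copp cadd.
Proof. by move=> f; apply: charm_eq => x /=; rewrite addNr. Qed.
HB.instance Definition _ := GRing.isZmodule.Build charm caddA caddC cadd0 caddN.

Lemma cscaleA a b v : cscale a (cscale b v) = cscale (a * b) v.
Proof. by apply: charm_eq => x /=; rewrite mulrA. Qed.
Lemma cscale1 : left_id 1 cscale.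
Proof. by move=> f; apply: charm_eq => x /=; rewrite mulr1. Qed.
Lemma cscaleDr : right_distributive cscale +%R.
Proof. by move=> a f g; apply: charm_eq => x. Qed.
Lemma cscaleDl v : {morph cscale^~ v : a b / a + b}.
Proof. by move=> a b; apply: charm_eq => x /=; rewrite mulrDr (svalP v). Qed.
HB.instance Definition _ := GRing.Zmodule_isLmodule.Build R charm
  cscaleA cscale1 cscaleDr cscaleDl.

End CharacterModule.

(** For [E] the additive maps from [R] to rationals modulo integers, linear maps from a module to
    [E] correspond to additive maps to [U] by evaluation at 1. Both claims thus reduce to extending
    additive maps into the divisible group [U]. *)
Lemma inj_cogenerator (R : comPzRingType) : exists E : lmodType R,
  baer E /\ forall (M : lmodType R) (m : M), m <> 0 ->
    exists h : {linear M -> E}, h m <> 0.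
Proof.
have [U [bU tU]] := rat_mod_int.
pose E : lmodType R := charm R U.
have evD (y y' : E) x : sval (y + y') x = sval y x + sval y' x by [].
have evZ a (y : E) x : sval (a *: y) x = sval y (x * a) by [].
have ev0 x : sval (0 : E) x = 0 by [].
have evz (a : int) (y : E) x : sval y (x *~ a) = a *: sval y x.
  have yadd : additive (sval y : R -> U).
    have y0 : sval y 0 = 0.
      by apply/eqP; rewrite -(inj_eq (addrI (sval y 0))) -(svalP y) !addr0.
    by move=> u v; rewrite (svalP y); congr (_ + _); apply/eqP; rewrite -subr_eq0 opprK -(svalP y) addNr y0.
  pose f : {additive R -> U} := HB.pack (sval y) (GRing.isZmodMorphism.Build R U (sval y) yadd).
  by rewrite -[sval y _]/(f _) raddfMz -scaler_int intz.
exists E; split.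
- move=> I hI; have [I1 I2 I3] := hI.
  pose K (r : zmodule R) (u : U) := exists2 y, I r y & u = sval y 1.
  have [|h hh] := @baer_extend_relation int U (zmodule R) K bU.
  + split; first by exists 0.
      move=> a x _ x' _ [y Iy ->] [y' Iy' ->].
      exists (a%:~R *: y + y'); last by rewrite evD evZ -evz mul1r.
      change (I ((x : R) *~ a + x') (a%:~R *: y + y')); rewrite -mulrzl.
      exact: (I2 a%:~R _ _ _ _ Iy Iy').
    by move=> u [y /I3 -> ->].
  have hadd x y : h (x + y) = h x + h y by rewrite linearD.
  pose e : E := exist _ (h : R -> U) hadd.
  exists e => r y Iry; apply: charm_eq => x.
  rewrite evZ /=; rewrite -(hh (x * r) (sval y x)) //.
  exists (x *: y); last by rewrite evZ mul1r.
  by have := I2 x _ _ _ _ Iry I1; rewrite !addr0.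
move=> M m m0.
(* If [m] has infinite additive order any nonzero [u0] will do; otherwise the order is some [k.+2],
   since [m] is nonzero, and [u0] is chosen to be killed by it. *)
have [u0 u00 hu0] : exists2 u0 : U, u0 != 0 & forall a : int, m *~ a = 0 -> a *: u0 = 0.
  have [[k0 hk0]|no] := pselect (exists k : nat, m *+ k.+1 = 0); last first.
    have [u [u0 _]] := tU 0%N; exists u => // -[[|k]|k] h; rewrite ?scale0r //.
      by case: no; exists k.
    by case: no; exists k; apply/eqP; rewrite -oppr_eq0 -h NegzE mulrNz.
  pose P k := `[< m *+ k.+1 = 0 >].
  have exP : exists k, P k by exists k0; apply/asboolP.
  case: (ex_minnP exP) => -[|k] /asboolP hk kmin; first by rewrite mulr1n in hk.
  have [u [u0 ku]] := tU k; exists u => // a ma.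
  have da := divz_eq a k.+2.
  have s0 : 0 <= (a %% k.+2)%Z by apply: modz_ge0.
  have sm : (a %% k.+2)%Z < k.+2%:Z by rewrite -[X in _ < X]gez0_abs //; apply: ltz_mod.
  have ms : m *~ (a %% k.+2)%Z = 0.
    by move: ma; rewrite {1}da mulrzDr mulrC mulrzA -pmulrn hk mul0rz add0r.
  move: da s0 sm ms; case: (a %% k.+2)%Z => // -[|n] da _ sm ms.
    by rewrite da addr0 -scalerA ku scaler0.
  have /kmin : P n by apply/asboolP.
  by move=> kn; move: sm kn; lia.
pose K (x : zmodule M) (u : U) := exists a : int, x = (m *~ a) /\ u = a *: u0.
have [|h hh] := @baer_extend_relation int U (zmodule M) K bU.
- split; first by exists 0; rewrite mulr0z scale0r.
    move=> a _ _ _ _ [b [-> ->]] [c [-> ->]]; exists (a * b + c).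
    by rewrite scalezrE -mulrzA mulrC mulrzDr scalerDl scalerA.
  by move=> u [a [/esym/hu0 e ->]].
have fadd x : forall r s : R, h ((r + s) *: x : M) = h (r *: x) + h (s *: x).
  by move=> r s; rewrite scalerDl (linearD h).
pose f x : E := exist _ (fun r => h (r *: x : M)) (fadd x).
have fl : linear f.
  move=> a x y; apply: charm_eq => r; rewrite evD evZ /=.
  by rewrite scalerDr (linearD h) scalerA.
exists (mklin fl) => /(congr1 (fun z : E => sval z 1)) /=.
rewrite scale1r -(hh m u0); first by apply/eqP.
by exists 1; rewrite mulr1z scale1r.
Qed.

(** * Duality and flatness *)

Lemma baer_extend (R : comPzRingType) (E M N : lmodType R) (i : {linear M -> N})
    (g : {linear M -> E}) : baer E -> injective i ->
  exists h : {linear N -> E}, forall m, h (i m) = g m.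
Proof.
move=> bE ii; have [|h hh] := @baer_extend_relation R E N (fun n y => exists2 m, n = i m & y = g m) bE.
  split; first by exists 0; rewrite linear0.
    by move=> a _ _ _ _ [m -> ->] [m' -> ->]; exists (a *: m + m'); rewrite linearP.
  by move=> y [m e ->]; rewrite -(ii 0 m) ?linear0.
by exists h => m; rewrite -(hh (i m) (g m)) //; exists m.
Qed.

Lemma baer_retract (R : comPzRingType) (E E' : lmodType R) :
  retract E' E -> baer E -> baer E'.
Proof.
move=> [i [r ri]] bE I hI; have [I1 I2 I3] := hI.
have [|e he] := bE (fun a y => exists2 y', I a y' & y = i y').
  split; first by exists 0; rewrite ?linear0.
    by move=> a x _ x' _ [y h ->] [y' h' ->]; exists (a *: y + y'); rewrite ?linearP //; apply: I2.
  by move=> _ [y /I3 -> ->]; rewrite linear0.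
exists (r e) => a y h; rewrite -[LHS]ri (he a (i y)) ?lin_scale //; by exists y.
Qed.

(* Flatness in the form of the equational criterion. *)
Definition eflat (R : comPzRingType) (F : lmodType R) :=
  forall (T : finType) (a : T -> R) (x : T -> F), \sum_t a t *: x t = 0 ->
    exists (J : finType) (b : T -> J -> R) (y : J -> F),
      (forall t, x t = \sum_j b t j *: y j) /\ forall j, \sum_t a t * b t j = 0.

Section Dual.
Variables (R : comPzRingType) (E : lmodType R).
Implicit Types A F K M N P Y : lmodType R.

Lemma hom_submod N : submod (fun f : prodm (fun _ : N => E) => linear (f : N -> E)).
Proof.
split; first by move=> a x y; rewrite !prodm0 scaler0 addr0.
move=> a f g hf hg b x y; rewrite !prodmD !prodmZ hf hg !scalerDr !scalerA mulrC.
by rewrite addrACA.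
Qed.

Definition dual N : lmodType R := subm (Submodule (hom_submod N)).

Lemma ev_linear N (d : dual N) : linear (sval d : N -> E).
Proof. by have /submemP := svalP d. Qed.
Definition ev N (d : dual N) : {linear N -> E} := mklin (ev_linear d).

Lemma evP N a (d d' : dual N) x : ev (a *: d + d') x = a *: ev d x + ev d' x.
Proof. by []. Qed.

Lemma dual_ext N (d d' : dual N) : (forall x, ev d x = ev d' x) -> d = d'.
Proof. by move=> h; apply: val_inj; apply: functional_extensionality_dep. Qed.

Lemma evl_linear N x : linear (fun d : dual N => ev d x).
Proof. by move=> a d d'; rewrite evP. Qed.
Definition evl N x : {linear dual N -> E} := mklin (@evl_linear N x).

Lemma ev0 N x : ev (0 : dual N) x = 0. Proof. exact: (linear0 (evl x)). Qed.
Lemma evB N (d d' : dual N) x : ev (d - d') x = ev d x - ev d' x.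
Proof. exact: (linearB (evl x)). Qed.
Lemma evZ N a (d : dual N) x : ev (a *: d) x = a *: ev d x.
Proof. by rewrite -[a *: d]addr0 evP ev0 addr0. Qed.
Lemma ev_sum N (T : finType) (d : T -> dual N) x :
  ev (\sum_t d t) x = \sum_t ev (d t) x.
Proof. exact: (linear_sum (evl x)). Qed.

Definition dual_of N (h : N -> E) (hl : linear h) : dual N :=
  @exist (prodm (fun _ : N => E)) (fun f => f \in submem (Submodule (hom_submod N)))
    h (introT (@submemP _ _ (Submodule (hom_submod N)) h) hl).

Lemma to_dual A N (b : A -> N -> E) :
  (forall n, linear (b^~ n)) -> (forall a, linear (b a)) ->
  exists h : {linear A -> dual N}, forall a n, ev (h a) n = b a n.
Proof.
move=> bl br.
pose f a := dual_of (br a).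
have fl : linear f by move=> c x y; apply: dual_ext => n; rewrite evP /= bl.
by exists (mklin fl).
Qed.

Lemma mk_dual N (h : {linear N -> E}) : exists d : dual N, forall x, ev d x = h x.
Proof.
by exists (dual_of (linearP h)).
Qed.

Lemma dmap_ex M N (f : {linear M -> N}) : exists h : {linear dual N -> dual M},
  forall d m, ev (h d) m = ev d (f m).
Proof.
apply: to_dual => [n|a] c x y; first by rewrite evP.
by rewrite !linearP.
Qed.

Lemma bidual_ex Y : exists h : {linear Y -> dual (dual Y)},
  forall y d, ev (h y) d = ev d y.
Proof. by apply: to_dual => [n|a] c x y; rewrite ?linearP. Qed.

(** A map from an ideal [I] to [dual E F] is a map from the tensor product of [I] and [F] to [E]. By
    the equational criterion it descends to the submodule [I F] of [F], with graph [K], and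
    injectivity of [E] extends it to [F]. *)
Lemma eflat_dual_baer F : baer E -> eflat F -> baer (dual F).
Proof.
move=> bE fF I hI; have [I1 I2 I3] := hI.
pose K (x : F) (e : E) := exists (T : finType) (r : T -> R) (y : T -> dual F) (z : T -> F),
  [/\ forall t, I (r t) (y t), x = \sum_t r t *: z t & e = \sum_t ev (y t) (z t)].
have [|h hh] := @baer_extend_relation R E F K bE.
  split.
  - exists void, (fun _ => 0), (fun _ => 0), (fun _ => 0); split; first by case.
      by rewrite big1 // => -[].
    by rewrite big1 // => -[].
  - move=> a _ _ _ _ [T [r [y [z [h -> ->]]]]] [T' [r' [y' [z' [h' -> ->]]]]].
    exists (T + T')%type, (fun t => match t with inl t => r t | inr t => r' t end),
     (fun t => match t with inl t => y t | inr t => y' t end),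
     (fun t => match t with inl t => a *: z t | inr t => z' t end); split.
    + by case.
    + rewrite big_sumType /=; congr (_ + _); rewrite scaler_sumr; apply: eq_bigr => t _.
      by rewrite !scalerA mulrC.
    + rewrite big_sumType /=; congr (_ + _); rewrite scaler_sumr; apply: eq_bigr => t _.
      exact: (esym (lin_scale (ev (y t)) a (z t))).
  - move=> e [T [r [y [z [h /esym/fF[J [b [w [zE rb]]]] ->]]]]].
    under eq_bigr => t _ do rewrite zE linear_sum.
    rewrite exchange_big big1 // => j _.
    under eq_bigr => t _ do rewrite lin_scale -evZ.
    rewrite -ev_sum -[RHS](ev0 (w j)); congr (ev _ _); apply: I3.
    rewrite -[0](rb j).
    elim/big_rec2: _ => // t u v _ huv; have := I2 (b t j) _ _ _ _ (h t) huv.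
    by rewrite [r t * _]mulrC.
have [d dE] := mk_dual h; exists d => r y Iry; apply: dual_ext => x.
rewrite evZ dE -lin_scale; apply: hh.
by exists unit, (fun=> r), (fun=> y), (fun=> x); split=> //; rewrite (big_pred1 tt) // => -[].
Qed.

End Dual.

(** * Hom-tensor adjunction, purity and injective duals *)

Section Tensors.
Variables (R : comPzRingType) (E : lmodType R).
Hypothesis bE : baer E.
Hypothesis cogen : forall (M : lmodType R) (m : M), m <> 0 ->
    exists h : {linear M -> E}, h m <> 0.
Implicit Types A F K M N P Y : lmodType R.

Lemma tens_linl M N y : linear (fun x : M => @tens R M N x y).
Proof. by move=> a x x'; rewrite tensDl tensZl. Qed.
Lemma tens_linr M N x : linear (@tens R M N x).
Proof. by move=> a y y'; rewrite tensDr tensZr. Qed.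

Lemma tens_ext M N P (g g' : {linear tensor M N -> P}) :
  (forall x y, g (tens x y) = g' (tens x y)) -> forall u, g u = g' u.
Proof.
move=> h; elim/tensW=> s; rewrite pi_tensE !linear_sum.
by apply: eq_bigr => p _.
Qed.

Definition ltmap M N F (f : {linear M -> N}) : {linear tensor M F -> tensor N F} :=
  mklin (tens_map_linear (F := F) f).

Lemma tens_ev M N (g : {linear M -> dual E N}) :
  exists h : {linear tensor M N -> E}, forall x y, h (tens x y) = ev (g x) y.
Proof.
have bl y : linear (fun x => ev (g x) y) by move=> a x x'; rewrite linearP.
have br x : linear (fun y => ev (g x) y) by move=> a y y'; rewrite linearP.
by exists (mklin (tens_lift_linear bl br)) => x y; apply: tens_liftE.
Qed.

Lemma ev_tens M N (h : {linear tensor M N -> E}) :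
  exists g : {linear M -> dual E N}, forall x y, ev (g x) y = h (tens x y).
Proof.
apply: to_dual => [y|x] a u v; first by rewrite tens_linl linearP.
by rewrite tens_linr linearP.
Qed.

(** A nonzero element of the kernel would be detected by a map to [E]; by adjunction and injectivity
    of [dual E F] that map extends along [tens_map], hence kills the element. *)
Lemma flat_of_dual_baer F : baer (dual E F) -> flat F.
Proof.
move=> bF M N f fi; apply: (lker0 (f := ltmap F f)) => u fu0.
have [//|/cogen[h hu]] := pselect (u = 0); case: hu.
have [g gE] := ev_tens h; have [g' g'E] := baer_extend g bF fi.
have [h' h'E] := tens_ev g'.
have -> : h u = lcomp h' (ltmap F f) u.
  by apply: tens_ext => x y /=; rewrite tens_mapE h'E g'E gE.
exact: (etrans (congr1 h' fu0) (linear0 h')).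
Qed.

Definition leval A (s : seq (R * A)) := \sum_(p <- s) p.1 *: p.2.
Definition lsubst (A B : Type) (r : A -> B) (s : seq (R * A)) := [seq (p.1, r p.2) | p <- s].

(* Purity of [K] in [A], phrased as the existence, for every finite set of
   linear relations between elements of [A], of a map to [K] fixing [K] and
   preserving these relations. *)
Definition pure K A (j : {linear K -> A}) :=
  forall rels : seq (seq (R * A)), (forall s, s \in rels -> leval s = 0) ->
    exists2 r : A -> K, (forall k, r (j k) = k) &
      forall s, s \in rels -> leval (lsubst r s) = 0.

(** A derivation of equality of tensors uses only finitely many linear relations in [A]. Any map
    preserving these, linear or not, transports the derivation. *)
Lemma tens_rel_finite A N (s t : seq (A * N)) : tens_rel s t ->
  exists2 rels : seq (seq (R * A)), (forall s, s \in rels -> leval s = 0) &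
    forall (U : lmodType R) (r : A -> U),
      (forall s, s \in rels -> leval (lsubst r s) = 0) ->
      \sum_(p <- s) tens (r p.1) p.2 = \sum_(p <- t) tens (r p.1) p.2.
Proof.
elim=> {s t} [s|s t _ [l lh h]|s t u _ [l lh h] _ [l' lh' h']|
  s s' t t' _ [l lh h] _ [l' lh' h']|s t|y|x x' y|x y y'|b x y].
- by exists [::].
- by exists l => // U r /h ->.
- exists (l ++ l') => [v|U r hr]; first by rewrite mem_cat => /orP[/lh|/lh'].
  rewrite h ?h' // => v vl; apply: hr; rewrite mem_cat vl ?orbT //.
- exists (l ++ l') => [v|U r hr]; first by rewrite mem_cat => /orP[/lh|/lh'].
  rewrite !big_cat /= h ?h' // => v vl; apply: hr; rewrite mem_cat vl ?orbT //.
- by exists [::] => // U r _; rewrite !big_cat /= addrC.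
- exists [:: [:: (1, 0)]] => [v|U r /(_ [:: (1, 0)])].
    by rewrite inE => /eqP ->; rewrite /leval big_seq1 scaler0.
  rewrite inE eqxx /leval big_seq1 /= scale1r => /(_ isT) r0.
  rewrite big_seq1 big_nil /= r0.
  exact: (linear0 (mklin (@tens_linl U N y))).
- exists [:: [:: (1, x + x'); (-1, x); (-1, x')]] => [v|U r /(_ [:: (1, x + x'); (-1, x); (-1, x')])].
    rewrite inE => /eqP ->; rewrite /leval !big_cons big_nil /= !scaleN1r scale1r addr0.
    by rewrite -opprD subrr.
  rewrite inE eqxx /leval !big_cons !big_nil /= !scaleN1r scale1r !addr0 -opprD.
  by move=> /(_ isT)/eqP; rewrite subr_eq0 => /eqP ->; rewrite tensDl.
- by exists [::] => // U r _; rewrite !big_cons !big_nil /= !addr0 tensDr.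
- exists [:: [:: (1, b *: x); (- b, x)]] => [v|U r /(_ [:: (1, b *: x); (- b, x)])].
    rewrite inE => /eqP ->; rewrite /leval !big_cons big_nil /= scaleNr scale1r addr0.
    by rewrite subrr.
  rewrite inE eqxx /leval !big_cons !big_nil /= scaleNr scale1r !addr0.
  by move=> /(_ isT)/eqP; rewrite subr_eq0 => /eqP ->; rewrite tensZl tensZr.
Qed.

Lemma pure_tens_inj K A N (j : {linear K -> A}) : pure j ->
  injective (@tens_map R K A N j).
Proof.
move=> pj; apply: (lker0 (f := ltmap N j)); elim/tensW=> s.
rewrite pi_tensE linear_sum => hs.
have : tens_rel [seq (j p.1, p.2) | p <- s] [::].
  apply/tens_eqP; rewrite !pi_tensE big_nil big_map -[RHS]hs.
  by apply: eq_bigr => p _; rewrite /= tens_mapE.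
case/tens_rel_finite=> rels /pj[r rj hr] /(_ _ _ hr).
rewrite big_nil big_map => {2}<-; apply: eq_bigr => p _.
by rewrite /= rj.
Qed.

(** Dual modules are pure-injective: by adjunction the extension problem becomes one for maps to [E]
    along the injection [tens_map j]. *)
Lemma pure_dual_ext K A N (j : {linear K -> A}) (g : {linear K -> dual E N}) :
  pure j -> exists h : {linear A -> dual E N}, forall k, h (j k) = g k.
Proof.
move=> pj; have [h hE] := tens_ev g.
have [h' h'E] := @baer_extend R E _ _ (ltmap N j) h bE (pure_tens_inj pj).
have [f fE] := ev_tens h'; exists f => k; apply: dual_ext => n.
by rewrite fE -hE -h'E /= tens_mapE.
Qed.

(* The injective module [dual E F] splits off [dual E P]. *)
Lemma dual_baer_split K P F (j : {linear K -> P}) (p : {linear P -> F}) :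
  baer (dual E F) -> ses j p ->
  exists sg : {linear dual E K -> dual E P}, forall d k, ev (sg d) (j k) = ev d k.
Proof.
move=> bF hs; have [ji sp kp] := hs.
have [q qE] := dmap_ex E p.
have qi : injective q.
  apply: lker0 => d qd; apply: dual_ext => f; have [x <-] := sp f.
  by rewrite -qE qd !ev0.
have [r rE] := baer_extend (lid _) bF qi.
(* Two extensions [t] of the same [d] differ by an element of the image of [q], on which
   [t - q (r t)] vanishes; hence the relation is single-valued. *)
pose G (d : dual E K) (e : dual E P) := exists2 t : dual E P,
  (forall k, ev t (j k) = ev d k) & e = t - q (r t).
have [||h hG] := @lin_of_rel _ _ _ G.
- split; first by exists 0 => [k|]; rewrite ?ev0 // (linear0 r) (linear0 q) subr0.
    move=> a d _ d' _ [t ht ->] [t' ht' ->]; exists (a *: t + t').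
      by move=> k; rewrite !evP ht ht'.
    by rewrite !linearP addrACA -scalerDr.
  move=> y [t ht ->].
  have [c cE] := @factor_ses _ _ _ _ _ j p (ev t) hs (fun k => etrans (ht k) (ev0 _ _)).
  have [d dE] := mk_dual c.
  have -> : t = q d by apply: dual_ext => x; rewrite qE dE cE.
  by rewrite rE subrr.
- move=> d; have [c cE] := baer_extend (ev d) bE ji; have [t tE] := mk_dual c.
  by exists (t - q (r t)), t => // k; rewrite tE cE.
exists h => d k; have [t ht ->] := hG d.
by rewrite evB ht qE (ses0 k hs) linear0 subr0.
Qed.

(** This is Ext^1(F, dual E N) = 0 for flat [F]. Exchanging arguments turns [g] into a map from [N]
    to [dual E K], which lifts to [dual E P] by the splitting. *)
Lemma dual_baer_extend K P F N (j : {linear K -> P}) (p : {linear P -> F})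
    (g : {linear K -> dual E N}) :
  baer (dual E F) -> ses j p ->
  exists h : {linear P -> dual E N}, forall k, h (j k) = g k.
Proof.
move=> bF hs; have [sg sgE] := dual_baer_split bF hs.
have [g' g'E] : exists g' : {linear N -> dual E K}, forall n k, ev (g' n) k = ev (g k) n.
  by apply: to_dual => [k|n] a x y; rewrite !linearP.
have [h hE] : exists h : {linear P -> dual E N}, forall x n, ev (h x) n = ev (sg (g' n)) x.
  by apply: to_dual => [k|n] a x y; rewrite !linearP.
by exists h => k; apply: dual_ext => n; rewrite hE sgE g'E.
Qed.

Lemma dual_baer_ker K P F (j : {linear K -> P}) (p : {linear P -> F}) :
  baer (dual E F) -> ses j p -> baer (dual E P) -> baer (dual E K).
Proof.
move=> bF hs; apply: baer_retract.
have [sg sgE] := dual_baer_split bF hs; have [q qE] := dmap_ex E j.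
by exists sg, q => d; apply: dual_ext => k; rewrite qE sgE.
Qed.

End Tensors.

(** * Flat modules, biduals and coherence *)

Section Flatness.
Variables (R : comPzRingType) (E : lmodType R).
Hypothesis bE : baer E.
Hypothesis cogen : forall (M : lmodType R) (m : M), m <> 0 ->
    exists h : {linear M -> E}, h m <> 0.
Implicit Types A C F K M N P Q Y : lmodType R.

(** After lifting the [x t] to a free module, their coordinates form the matrix [b]; only finitely
    many basis elements [l] occur. *)
Lemma proj_eflat P : projective P -> eflat P.
Proof.
move=> hP T a x ax0; have [D [inc [pr [p [_ sp pE dec]]]]] := free_cover P.
have [s sE] := hP _ _ p (lid P) sp.
have ex t : exists S : seq {classic P}, [/\ uniq S,
    forall j : {classic P}, j \notin S -> pr j (s (x t)) = 0 &
     s (x t) = \sum_(j <- S) inc j (pr j (s (x t)))].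
  by have [l ul [h0 e]] := dec (s (x t)); exists l.
have [S SP] := choice ex.
pose l := undup (flatten [seq S t | t <- enum T]).
exists 'I_(size l), (fun t i => pr (tnth (in_tuple l) i) (s (x t))),
  (fun i => tnth (in_tuple l) i); split.
  move=> t; have [ut h0 e] := SP t.
  rewrite -[LHS]sE /lid /= [in LHS]e linear_sum.
  rewrite (@sum_support R P P _ (S t) l) ?undup_uniq //.
  - by rewrite [LHS]big_tnth; apply: eq_bigr => i _; rewrite pE.
  - move=> j js; rewrite mem_undup; apply/flattenP; exists (S t) => //.
    by apply/mapP; exists t => //; rewrite mem_enum.
  - by move=> j js; rewrite h0 // !linear0.
move=> i; set k := tnth _ i.
have -> : \sum_t a t * pr k (s (x t)) = pr k (s (\sum_t a t *: x t)).
  by rewrite !linear_sum; apply: eq_bigr => t _; rewrite !lin_scale.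
by rewrite ax0 !linear0.
Qed.

(** The last hypothesis is purity of the kernel for one equation: it corrects lifts of a relation in
    [F] to an exact relation in [Q]. *)
Lemma quot_eflat Q F (p : {linear Q -> F}) : eflat Q -> surjective p ->
  (forall (T : finType) (a : T -> R) (q : T -> Q), p (\sum_t a t *: q t) = 0 ->
    exists2 q' : T -> Q, (forall t, p (q' t) = 0) &
       \sum_t a t *: q' t = \sum_t a t *: q t) -> eflat F.
Proof.
move=> fQ sp pu T a x ax0.
have [q qE] := @choice T Q (fun t q => p q = x t) (fun t => sp (x t)).
have [|q' q'0 q'E] := pu T a q.
  rewrite linear_sum -[RHS]ax0; apply: eq_bigr => t _.
  by rewrite lin_scale qE.
have [|J [b [y [yE rb]]]] := fQ T a (fun t => q t - q' t).
  under eq_bigr => t _ do rewrite scalerBr.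
  by rewrite sumrB q'E subrr.
exists J, b, (fun j => p (y j)); split=> // t.
have : p (q t - q' t) = x t by rewrite linearB q'0 qE subr0.
by move=> <-; rewrite yE linear_sum; apply: eq_bigr => j _; rewrite lin_scale.
Qed.

Lemma bidual_inj Y (h : {linear Y -> dual E (dual E Y)}) :
  (forall y d, ev (h y) d = ev d y) -> injective h.
Proof.
move=> hE; apply: lker0 => y hy.
have [//|/cogen[c cy]] := pselect (y = 0); case: cy.
have [d dE] := mk_dual c.
by rewrite -dE -hE hy ev0.
Qed.

(** Were [y] outside the submodule [S] of all sums of the [a t *: z t], some functional [d] would
    vanish on [S] but not at [y]. Then every [a t *: d] is zero, so the given solution in the bidual
    forces [d] to vanish at [y]. *)
Lemma bidual_pure Y (h : {linear Y -> dual E (dual E Y)}) :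
  (forall y d, ev (h y) d = ev d y) ->
  forall (T : finType) (a : T -> R) (q : T -> dual E (dual E Y)) y,
   \sum_t a t *: q t = h y -> exists z : T -> Y, \sum_t a t *: z t = y.
Proof.
move=> hE T a q y aq.
pose S (y : Y) := exists z : T -> Y, \sum_t a t *: z t = y.
have hS : submod S.
  split; first by exists (fun _ => 0); rewrite big1 // => t _; rewrite scaler0.
  move=> c _ _ [z <-] [z' <-]; exists (fun t => c *: z t + z' t).
  rewrite scaler_sumr -big_split; apply: eq_bigr => t _.
  by rewrite scalerDr !scalerA mulrC.
have [N [p [sp pP]]] := quot_ex hS.
apply/pP; have [//|/cogen[c cy]] := pselect (p y = 0); case: cy.
have [d dE] := mk_dual (lcomp c p).
have -> : c (p y) = ev (h y) d by rewrite hE dE.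
rewrite -aq ev_sum big1 // => t _; rewrite evZ -lin_scale.
suff -> : a t *: d = 0 by rewrite linear0.
apply: dual_ext => w; rewrite evZ ev0 dE /= -!lin_scale.
have -> : p (a t *: w) = 0; last by rewrite linear0.
apply/pP; exists (fun u => if u == t then w else 0).
rewrite (bigD1 t) //= eqxx big1 ?addr0 // => u /negbTE ->; exact: scaler0.
Qed.

Lemma rV_lift n M (x : 'I_n -> M) : exists h : {linear 'rV[R]_n -> M},
  forall v, h v = \sum_i v 0 i *: x i.
Proof.
have hl : linear (fun v : 'rV[R]_n => \sum_i v 0 i *: x i).
  move=> a u v; rewrite scaler_sumr -big_split; apply: eq_bigr => i _.
  by rewrite !mxE scalerDl scalerA.
by exists (mklin hl).
Qed.

(** Coherence gives some finite presentation of the ideal generated by the [a i]; comparing covers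
    as in Schanuel's lemma transfers finite generation of the relations to these generators. *)
Lemma coherent_relations n (a : 'I_n -> R) : coherent R ->
  exists (J : finType) (c : J -> 'I_n -> R),
    (forall j, \sum_i c j i * a i = 0) /\
    forall v : 'I_n -> R, \sum_i v i * a i = 0 ->
      exists w : J -> R, forall i, v i = \sum_j w j * c j i.
Proof.
move=> hc; have [f fE] := @rV_lift n R^o a.
have [K [j [ji jP]]] := sub_ex (im_submod f).
have [p pE] := factor_inj ji (fun v => (jP (f v)).1 (ex_intro _ v erefl)).
have sp : surjective p.
  move=> k; have [v ev] := (jP (j k)).2 (ex_intro _ k erefl).
  by exists v; apply: ji; rewrite pE.
have [|m [n' [r [p' [sp' kp']]]]] := hc K j ji; first by exists n, p.
have [x xE] := @choice 'I_n _ (fun i y => p' y = p (delta_mx 0 i))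
   (fun i => sp' (p (delta_mx 0 i))).
have [al alE] := rV_lift x.
have [y yE] := @choice 'I_n' _ (fun i y => p y = p' (delta_mx 0 i))
   (fun i => sp (p' (delta_mx 0 i))).
have [be beE] := rV_lift y.
have pal v : p' (al v) = p v.
  rewrite alE [v in RHS]row_sum_delta !linear_sum; apply: eq_bigr => i _.
  by rewrite !lin_scale xE.
have pbe v : p (be v) = p' v.
  rewrite beE [v in RHS]row_sum_delta !linear_sum; apply: eq_bigr => i _.
  by rewrite !lin_scale yE.
have fp v : f v = 0 <-> p v = 0.
  rewrite -pE; split=> [|->]; last by rewrite linear0.
  by rewrite -{1}(linear0 j) => /ji.
(* A relation [v] is the sum of [v - be (al v)], a combination of the [g i], and of [be (al v)],
   where [al v] lies in the image of [r]. *)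
pose g (i : 'I_n) : 'rV[R]_n := delta_mx 0 i - be (al (delta_mx 0 i)).
pose g' (l : 'I_m) : 'rV[R]_n := be (r (delta_mx 0 l)).
pose c (t : 'I_n + 'I_m) : 'rV[R]_n := match t with inl i => g i | inr l => g' l end.
exists ('I_n + 'I_m)%type, (fun t i => c t 0 i); split.
  move=> t; rewrite -fE; apply/fp; case: t => [i|l] /=.
    by rewrite linearB pbe pal subrr.
  by rewrite pbe; apply/kp'; exists (delta_mx 0 l).
move=> v hv; pose V : 'rV[R]_n := \row_i v i.
have pV : p V = 0.
  by apply/fp; rewrite fE -[RHS]hv; apply: eq_bigr => i _; rewrite mxE.
have [u uE] : exists u, r u = al V by apply/kp'; rewrite pal.
exists (fun t => match t with inl i => V 0 i | inr l => u 0 l end) => i.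
have -> : v i = V 0 i by rewrite mxE.
have VE : V = \sum_(t : 'I_n + 'I_m)
    (match t with inl i => V 0 i | inr l => u 0 l end) *: c t.
  rewrite big_sumType /=.
  have -> : \sum_i V 0 i *: g i = V - be (al V).
    rewrite [V in RHS]row_sum_delta (linear_sum al) (linear_sum be) -sumrB; apply: eq_bigr => k _.
    by rewrite (lin_scale al) (lin_scale be) scalerBr.
  have -> : \sum_i u 0 i *: g' i = be (r u).
    rewrite [u in RHS]row_sum_delta !linear_sum; apply: eq_bigr => k _.
    by rewrite !lin_scale.
  by rewrite uE subrK.
by rewrite {1}VE summxE; apply: eq_bigr => t _; rewrite mxE.
Qed.

(** With finitely many generating relations [c] among the [a i], sending the family of all
    [\sum_i c j i *: v i] to [\sum_i ev (x i) (v i)] is a partial map from a finite power of [N] to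
    [E]. The components of its extension are the new elements [psi j]. *)
Lemma coherent_dual_eflat N : coherent R -> baer N -> eflat (dual E N).
Proof.
move=> hc bN T a0 x0 ax0.
pose n := #|T|; pose a (i : 'I_n) := a0 (enum_val i); pose x (i : 'I_n) := x0 (enum_val i).
have ax : \sum_i a i *: x i = 0.
  by rewrite -[RHS]ax0 -(big_enum_val (fun t => a0 t *: x0 t)); apply: eq_bigl.
have [J [c [c0 cP]]] := coherent_relations a hc.
pose K (z : prodm (fun _ : J => N)) (e : E) := exists v : 'I_n -> N,
  (forall j, z j = \sum_i c j i *: v i) /\ e = \sum_i ev (x i) (v i).
have [|h hh] := @baer_extend_relation R E (prodm (fun _ : J => N)) K bE.
  split.
  - exists (fun _ => 0); split=> [j|]; last by rewrite big1 // => i _; rewrite linear0.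
    by rewrite big1 // => i _; rewrite scaler0.
  - move=> b z _ z' _ [v [zE ->]] [v' [z'E ->]].
    exists (fun i => b *: v i + v' i); split=> [j|].
      rewrite prodmD prodmZ zE z'E scaler_sumr -big_split; apply: eq_bigr => i _.
      by rewrite scalerDr !scalerA mulrC.
    rewrite scaler_sumr -big_split; apply: eq_bigr => i _.
    by rewrite linearP.
  - move=> e [v [cv ->]].
    (* When the family vanishes, [a i] maps to [v i] consistently on the ideal; injectivity of [N]
       gives [v i = a i *: z], and the relation between the [x i] kills the value. *)
    have [|z zP] := bN (fun r y => exists w : 'I_n -> R,
        r = \sum_i w i * a i /\ y = \sum_i w i *: v i).
      split.
      - exists (fun _ => 0); split; first by rewrite big1 // => i _; rewrite mul0r.
        by rewrite big1 // => i _; rewrite scale0r.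
      - move=> b _ _ _ _ [w [-> ->]] [w' [-> ->]]; exists (fun i => b * w i + w' i); split.
          rewrite scaler_sumr -big_split; apply: eq_bigr => i _.
          by rewrite mulrDl -mulrA.
        rewrite scaler_sumr -big_split; apply: eq_bigr => i _.
        by rewrite scalerDl scalerA.
      - move=> y [w [/esym/cP[u uE] ->]].
        under eq_bigr => i _ do rewrite uE scaler_suml.
        rewrite exchange_big big1 // => j _.
        under eq_bigr => i _ do rewrite -scalerA.
        by rewrite -scaler_sumr -cv prodm0 scaler0.
    have vE i : v i = a i *: z.
      apply: zP; exists (fun k => if k == i then 1 else 0); split.
        by rewrite (bigD1 i) //= eqxx mul1r big1 ?addr0 // => k /negbTE ->; rewrite mul0r.
      by rewrite (bigD1 i) //= eqxx scale1r big1 ?addr0 // => k /negbTE ->; rewrite scale0r.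
    under eq_bigr => i _ do rewrite vE lin_scale -evZ.
    by rewrite -ev_sum ax ev0.
have inc j : exists k : {linear N -> prodm (fun _ : J => N)},
    forall z, k z = @single _ J (fun _ => N) j z.
  by exists (mklin (@single_linear R J (fun _ => N) j)).
have [k kE] := @dep_choice J (fun _ => {linear N -> prodm (fun _ : J => N)}) _ inc.
have [psi psiE] := @choice J (dual E N) (fun j d => forall z, ev d z = h (k j z))
  (fun j => mk_dual (lcomp h (k j))).
exists J, (fun t j => c j (enum_rank t)), psi; split.
  move=> t; apply: dual_ext => z; rewrite ev_sum.
  have -> : x0 t = x (enum_rank t) by rewrite /x enum_rankK.
  set i := enum_rank t.
  transitivity (h (\sum_j c j i *: k j z)).
    rewrite -(hh _ (ev (x i) z)) //.
    exists (fun l => if l == i then z else 0); split.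
      move=> j; rewrite prodm_sum (bigD1 j) //= prodmZ kE singleE big1 ?addr0.
        by rewrite (bigD1 i) //= eqxx big1 ?addr0 // => l /negbTE ->; rewrite scaler0.
      by move=> l /eqP lj; rewrite prodmZ kE singleN // scaler0.
    by rewrite (bigD1 i) //= eqxx big1 ?addr0 // => l /negbTE ->; exact: (linear0 (ev (x l))).
  by rewrite linear_sum; apply: eq_bigr => j _; rewrite lin_scale evZ psiE.
move=> j; rewrite -[RHS](c0 j).
have -> : \sum_t a0 t * c j (enum_rank t) = \sum_(i < n) a0 (enum_val i) * c j (enum_rank (enum_val i)).
  by rewrite -(big_enum_val (fun t => a0 t * c j (enum_rank t))); apply: eq_bigl.
by apply: eq_bigr => i _; rewrite enum_valK mulrC.
Qed.

Lemma flat_cosyzygy Y : coherent R -> eflat Y ->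
  exists (Y' : lmodType R) (i : {linear Y -> dual E (dual E Y)})
    (p : {linear dual E (dual E Y) -> Y'}),
  [/\ ses i p, eflat (dual E (dual E Y)) & eflat Y'].
Proof.
move=> hc fY; have [i iE] := bidual_ex E Y.
have [Y' [p hs]] := coker_ex (bidual_inj iE).
have fC := coherent_dual_eflat hc (eflat_dual_baer bE fY).
exists Y', i, p; split=> //; have [_ sp kp] := hs.
apply: quot_eflat fC sp _ => T a q /kp[y yq].
have [z zE] := bidual_pure iE (esym yq).
exists (fun t => i (z t)) => [t|]; first exact: ses0 hs.
by rewrite -yq -zE linear_sum; apply: eq_bigr => t _; rewrite lin_scale.
Qed.

End Flatness.

(** * Projective dimension and approximations *)

Section ProjectiveDimension.
Variable R : comPzRingType.
Implicit Types A B C F K L M N P Q X Y Z : lmodType R.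

(** Quantifying over all projective presentations makes hypotheses directly applicable; [schanuel]
    shows that one presentation suffices. *)
Fixpoint pd (k : nat) M : Prop :=
  if k is k'.+1 then
    forall K P (i : {linear K -> P}) (p : {linear P -> M}),
      projective P -> ses i p -> pd k' K
  else projective M.

Lemma schanuel M M' K P K' P' (i : {linear K -> P}) (p : {linear P -> M})
    (i' : {linear K' -> P'}) (p' : {linear P' -> M'}) :
  projective P -> projective P' -> ses i p -> ses i' p' -> retract M' M ->
  retract K' (K * P')%type.
Proof.
move=> hP hP' hs hs' [u [r ru]].
have [ii sp kp] := hs; have [ii' sp' kp'] := hs'.
have [a aE] := hP' _ _ p (lcomp u p') sp.
have [b bE] := hP _ _ p' (lcomp r p) sp'.
have [k kE] : exists k : {linear K' -> K}, forall x, i (k x) = lcomp a i' x.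
  apply: factor_inj ii _ => x; apply/kp.
  by rewrite aE /= (ses0 x hs') linear0.
(* Since [r u] is the identity, [p'] kills [c]; so [c] takes values in [K'], and it makes up for
   [b a] not being the identity. *)
pose c : {linear P' -> P'} := lsub (lcomp b a) (lid P').
have [l lE] : exists l : {linear (K * P')%type -> K'}, forall z, i' (l z) = lsub (lcomp (lcomp b i) (lfst _ _)) (lcomp c (lsnd _ _)) z.
  apply: factor_inj ii' _ => -[x y]; apply/kp'.
  rewrite /= !(linearB p') bE /= (ses0 x hs) linear0 bE /= aE /= ru subrr.
  by rewrite !linear0 addr0.
exists (lpair k i'), l => x; apply: ii'; rewrite lE /= kE /=.
by rewrite subKr.
Qed.

Lemma retractxx M : retract M M.
Proof. by exists (lid M), (lid M). Qed.

Lemma pd_retract k N P M' :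
  pd k N -> projective P -> retract M' (N * P)%type -> pd k M'.
Proof.
elim: k N P M' => [|k IH] N P M' hN hP hr.
  exact: retract_projective hr (pair_projective hN hP).
move=> K' P' i' p' hP' hs' /=.
have [K [P0 [i [p [hP0 hs]]]]] := proj_ses N.
have [ii sp kp] := hs.
pose q : {linear (P0 * P)%type -> (N * P)%type} :=
  lpair (lcomp p (lfst _ _)) (lsnd _ _).
pose j : {linear K -> (P0 * P)%type} := lpair i (lzero _ _).
have hq : ses j q.
  split.
  - by move=> x y [/ii].
  - by move=> [n x]; have [y <-] := sp n; exists (y, x).
  - move=> [y x]; split=> [[/kp[k' <-] ->]|[k' [<- <-]]]; first by exists k'.
    by congr pair; rewrite /= (ses0 k' hs).
apply: (IH K P' K' (hN _ _ _ _ hP0 hs)) => //.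
exact: schanuel (pair_projective hP0 hP) hP' hq hs' hr.
Qed.

Lemma pd_of_ses k K P M (i : {linear K -> P}) (p : {linear P -> M}) :
  projective P -> ses i p -> pd k K -> pd k.+1 M.
Proof.
move=> hP hs hK K' P' i' p' hP' hs'.
apply: (pd_retract hK hP'); exact: (schanuel hP hP' hs hs' (retractxx M)).
Qed.

Lemma pdim_le_pd d M : pdim_le d M -> pd d M.
Proof.
elim: d M => [|d IH] M [P [e [f [hP P0 se ke kf]]]].
  apply: retract_projective (hP 0%N).
  have [|g gE] := @factor_surj _ _ _ _ e (lid (P 0%N)) se.
    by move=> x /ke[y <-]; rewrite (P0 1%N isT y) /= linear0.
  by exists g, e => x; have [y <-] := se x; rewrite gE.
have [K [i hs]] := ker_ex se; have [ii _ ki] := hs.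
apply: (pd_of_ses (hP 0%N) hs); apply: IH.
have [e' eE] : exists e' : {linear P 1%N -> K}, forall x, i (e' x) = f 0%N x.
  by apply: factor_inj ii _ => x; apply/ki/ke; exists x.
exists (fun n => P n.+1), e', (fun n => f n.+1); split=> //.
- by move=> n dn; apply: P0.
- by move=> k; have [y hy] : exists y, f 0%N y = i k; [apply/ke/ki; exists k|exists y; apply: ii; rewrite eE].
- move=> x; rewrite -kf -eE; split=> [->|]; first by rewrite linear0.
  by rewrite -{1}(linear0 i) => /ii.
Qed.

End ProjectiveDimension.

Section StronglyGorenstein.
Variable R : comPzRingType.
Implicit Types A B C F K L M N P Q X Y Z : lmodType R.

(** If [Q] is projective, this is Ext^1(C, Y) = 0 for the cokernel [C] of [i]. *)
Definition hext A Q (i : {linear A -> Q}) Y :=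
  forall g : {linear A -> Y}, exists h : {linear Q -> Y}, forall x, h (i x) = g x.

(* [A] is a "strongly Gorenstein projective" module: a cycle module of a totally
   acyclic complex that is periodic of period one. *)
Definition sgp_data A Q (i : {linear A -> Q}) (p : {linear Q -> A}) :=
  [/\ projective Q, ses i p & forall Y, projective Y -> hext i Y].

Definition sgp A := exists Q (i : {linear A -> Q}) (p : {linear Q -> A}), sgp_data i p.

Lemma hext_retract A Q (i : {linear A -> Q}) Y Y' :
  retract Y' Y -> hext i Y -> hext i Y'.
Proof.
move=> [u [r ru]] h g; have [k kE] := h (lcomp u g).
by exists (lcomp r k) => x; rewrite /= kE /= ru.
Qed.

(** Ext^1(A, Y) lies between Ext^1(A, P) and Ext^2(A, Y1), and the latter is Ext^1(A, Y1) by
    periodicity. *)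
Lemma hext_quot A Q (i : {linear A -> Q}) (p : {linear Q -> A}) Y1 P Y
    (j : {linear Y1 -> P}) (q : {linear P -> Y}) :
  projective Q -> ses i p -> ses j q -> hext i P -> hext i Y1 -> hext i Y.
Proof.
move=> hQ hs ht hP h1 g; have [ii sp kp] := hs; have [ij sq kq] := ht.
have [k kE] := hQ _ _ q (lcomp g p) sq.
have [m mE] : exists m : {linear A -> Y1}, forall x, j (m x) = lcomp k i x.
  by apply: factor_inj ij _ => x; apply/kq; rewrite kE /= (ses0 x hs) linear0.
have [m' m'E] := h1 m.
have [l lE] := @factor_ses _ _ _ _ _ i p (lsub k (lcomp j m')) hs
  (fun x => ltac:(by rewrite /= m'E mE /= subrr)).
have [l' l'E] := hP l.
exists (lcomp q l') => a; have [x <-] := sp a.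
by rewrite /= l'E lE /= linearB kE /= (ses0 _ ht) subr0.
Qed.

(** By periodicity Ext^1(A, Y) is Ext^2(A, Y), which lies between Ext^1(A, Y') and Ext^2(A, C) =
    Ext^1(A, C). *)
Lemma hext_sub A Q (i : {linear A -> Q}) (p : {linear Q -> A}) Y C Y'
    (j : {linear Y -> C}) (q : {linear C -> Y'}) :
  projective Q -> ses i p -> ses j q -> hext i C -> hext i Y' -> hext i Y.
Proof.
move=> hQ hs ht hC h1 g; have [ii sp kp] := hs; have [ij sq kq] := ht.
have [k kE] := hC (lcomp j g).
have [l lE] := @factor_ses _ _ _ _ _ i p (lcomp q k) hs
  (fun x => ltac:(by rewrite /= kE /= (ses0 _ ht))).
have [l' l'E] := h1 l.
have [m mE] := hQ _ _ q l' sq.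
have [n nE] : exists n : {linear Q -> Y}, forall x, j (n x) = lsub k (lcomp m (lcomp i p)) x.
  apply: factor_inj ij _ => x; apply/kq.
  by rewrite /= linearB mE l'E lE /= subrr.
exists n => x; apply: ij; rewrite nE /= (ses0 x hs) !linear0 addr0 kE //.
Qed.

Lemma sgp_hext_pd A Q (i : {linear A -> Q}) (p : {linear Q -> A}) n Y :
  sgp_data i p -> pd n Y -> hext i Y.
Proof.
move=> [hQ hs hp]; elim: n Y => [|n IH] Y hY; first exact: hp.
have [K [P [j [q [hP ht]]]]] := proj_ses Y.
exact: (hext_quot hQ hs ht (hp _ hP) (IH _ (hY _ _ _ _ hP ht))).
Qed.

Lemma sgp_pair A B : sgp A -> sgp B -> sgp (A * B)%type.
Proof.
move=> [Q [i [p [hQ hs hp]]]] [Q' [i' [p' [hQ' hs' hp']]]].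
exists (Q * Q')%type, (lpair (lcomp i (lfst _ _)) (lcomp i' (lsnd _ _))),
 (lpair (lcomp p (lfst _ _)) (lcomp p' (lsnd _ _))).
have [ii sp kp] := hs; have [ii' sp' kp'] := hs'.
split; first exact: pair_projective.
  split.
  - by move=> [a b] [c d] [/ii -> /ii' ->].
  - by move=> [a b]; have [x <-] := sp a; have [y <-] := sp' b; exists (x, y).
  - move=> [a b]; split=> [[/kp[x <-] /kp'[y <-]]|[[x y] [<- <-]]]; first by exists (x, y).
    by congr pair; rewrite /= ?(ses0 _ hs) ?(ses0 _ hs').
move=> Y hY g.
pose j : {linear A -> (A * B)%type} := lpair (lid A) (lzero A B).
pose j' : {linear B -> (A * B)%type} := lpair (lzero B A) (lid B).
have [h hE] := hp _ hY (lcomp g j); have [h' h'E] := hp' _ hY (lcomp g j').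
exists (lcopair h h') => -[a b]; rewrite /= hE h'E /= -linearD; congr (g _).
change ((a + 0, 0 + b) = (a, b)); by rewrite addr0 add0r.
Qed.

Lemma proj_sgp P : projective P -> sgp P.
Proof.
move=> hP; exists (P * P)%type, (lpair (lzero P P) (lid P)), (lfst P P).
split; first exact: pair_projective.
  split.
  - by move=> x y [].
  - by move=> x; exists (x, 0).
  - by move=> [x y]; split=> [/= ->|[z [<- _]]]; first by exists y.
by move=> Y _ g; exists (lcomp g (lsnd _ _)).
Qed.

End StronglyGorenstein.

(** * Orthogonality to flat modules and approximation of flat sequences of period one *)

Section Approximation.
Variables (R : comPzRingType) (E : lmodType R) (d : nat).
Hypothesis bE : baer E.
Hypothesis cogen : forall (M : lmodType R) (m : M), m <> 0 ->
    exists h : {linear M -> E}, h m <> 0.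
Hypothesis hcoh : coherent R.
Hypothesis hperf : perfect d R.
Implicit Types A B C F K L M N P Q X Y Z : lmodType R.

Lemma eflat_pd F : eflat F -> pd d F.
Proof. by move=> hF; apply: pdim_le_pd; apply: hperf; apply: (flat_of_dual_baer cogen); apply: eflat_dual_baer. Qed.

Inductive cosyzygy : nat -> lmodType R -> Prop :=
| cosyz0 A : cosyzygy 0 A
| cosyzS n A N B (i : {linear A -> dual E N}) (p : {linear dual E N -> B}) :
    cosyzygy n A -> ses i p -> cosyzygy n.+1 B.

(* Dimension shifting: the obstruction to lifting lies in Ext^1(Z, A), which is
   Ext^(n+1)(Z, -) of the module whose [n]-th cosyzygy is [A]. *)
Lemma cosyzygy_lift n A N B (i : {linear A -> dual E N}) (p : {linear dual E N -> B}) Z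
    (z : {linear Z -> B}) :
  cosyzygy n A -> ses i p -> baer (dual E Z) -> pd n Z ->
  exists l : {linear Z -> dual E N}, forall x, p (l x) = z x.
Proof.
move=> cA; elim: cA N B i p Z z => {n A} [A|n A' N' A i' p' cA IH hs'] N B i p Z z hs dZ pZ.
  by have [_ sp _] := hs; apply: pZ.
have [K [P [j [q [hP ht]]]]] := proj_ses Z.
have [ij sq kq] := ht; have [ii sp kp] := hs.
have [l lE] := hP _ _ p (lcomp z q) sp.
have [k kE] : exists k : {linear K -> A}, forall x, i (k x) = lcomp l j x.
  by apply: factor_inj ii _ => x; apply/kp; rewrite lE /= (ses0 _ ht) linear0.
have dK := dual_baer_ker bE dZ ht (eflat_dual_baer bE (proj_eflat hP)).
have [k' k'E] := IH _ _ i' p' K k hs' dK (pZ _ _ _ _ hP ht).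
have [m mE] := dual_baer_extend bE k' dZ ht.
have [r rE] := @factor_ses _ _ _ _ _ j q (lsub l (lcomp i (lcomp p' m))) ht
  (fun x => ltac:(by rewrite /= mE k'E kE /= subrr)).
exists r => y; have [x <-] := sq y.
by rewrite rE /= linearB (ses0 _ hs) subr0 lE.
Qed.

(** The counter [m] records the cosyzygies already taken. By [hext_sub] the claim for [Y] follows
    from that for its next cosyzygy, flat duals being covered by the hypothesis. *)
Lemma hext_eflat A Q (i : {linear A -> Q}) (p : {linear Q -> A}) :
  projective Q -> ses i p -> (forall N, eflat (dual E N) -> hext i (dual E N)) ->
  forall n m Y, (n + m)%N = d -> cosyzygy m Y -> eflat Y -> hext i Y.
Proof.
(* The cosyzygy [Y'] is formed in both cases. For [n = 0] the module [Y] is itself a [d]-th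
   cosyzygy, so the identity of [Y'] lifts and [Y] is a summand of its bidual. *)
move=> hQ hs hC; elim=> [|n IH] m Y nm cY fY;
  have [Y' [j [q [ht fC fY']]]] := flat_cosyzygy bE cogen hcoh fY.
  have [l lE] : exists l : {linear Y' -> _}, forall x, q (l x) = lid Y' x.
    apply: (cosyzygy_lift (lid Y') cY ht (eflat_dual_baer bE fY')).
    by rewrite -[m]/(0 + m)%N nm; apply: eflat_pd.
  apply: (hext_retract _ (hC _ fC)).
  have [ij sq kq] := ht.
  have [r rE] : exists r : {linear _ -> Y}, forall x, j (r x) = lsub (lid _) (lcomp l q) x.
    by apply: factor_inj ij _ => x; apply/kq; rewrite /= linearB lE /= subrr.
  exists j, r => y; apply: ij; rewrite rE /= (ses0 _ ht) linear0 subr0 //.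
apply: (hext_sub hQ hs ht (hC _ fC)).
by apply: (IH m.+1) => //; [rewrite addnS|apply: cosyzS cY ht].
Qed.

Definition sgp_orth L := forall A Q (i : {linear A -> Q}) (p : {linear Q -> A}),
  sgp_data i p -> hext i L.

Lemma sgp_orth_lift L A X (l : {linear L -> A}) (a : {linear A -> X}) (T : lmodType R)
   (t : {linear T -> X}) :
  sgp_orth L -> ses l a -> sgp T -> exists h : {linear T -> A}, forall x, a (h x) = t x.
Proof.
move=> oL hs [Q [i [p hT]]]; have [hQ ht _] := hT.
have [il sa ka] := hs; have [ii sp kp] := ht.
have [k kE] := hQ _ _ a (lcomp t p) sa.
have [m mE] : exists m : {linear T -> L}, forall x, l (m x) = lcomp k i x.
  by apply: factor_inj il _ => x; apply/ka; rewrite kE /= (ses0 _ ht) linear0.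
have [m' m'E] := oL _ _ _ _ hT m.
have [h hE] := @factor_ses _ _ _ _ _ i p (lsub k (lcomp l m')) ht
  (fun x => ltac:(by rewrite /= m'E mE /= subrr)).
exists h => y; have [x <-] := sp y.
by rewrite hE /= linearB (ses0 _ hs) subr0 kE.
Qed.

(* In the inductive step [X1 -> F1 -> X1] is the kernel of a surjection from the
   split sequence [P -> P * P -> P]; if [A1] approximates [X1] with kernel [L1],
   then [A1 * P] approximates [X] with a kernel [L] in [L1 -> Q1 -> L]. *)
Lemma sgp_approximation k X F (i : {linear X -> F}) (p : {linear F -> X}) :
  ses i p -> baer (dual E F) -> pd k F ->
  (forall N, eflat (dual E N) -> hext i (dual E N)) ->
  exists L A (l : {linear L -> A}) (a : {linear A -> X}),
    [/\ sgp A, ses l a & sgp_orth L].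
Proof.
elim: k X F i p => [|k IH] X F i p hs dF pF hC.
  have [K [l hl]] : exists K (l : {linear K -> X}), ses l (lid X).
    by apply: ker_ex => x; exists x.
  (* Here [F] is projective, so [X] is its own approximation and the kernel [K] is zero. *)
  exists K, X, l, (lid X); split=> //.
    exists F, i, p; split=> // Y hY.
    apply: (hext_eflat pF hs hC (addn0 d)); first exact: cosyz0.
    exact: proj_eflat.
  move=> A Q j q _ g; exists (lzero Q K) => x /=.
  have [il _ kl] := hl; apply: il; rewrite linear0.
  by symmetry; apply: (ses0 _ hl).
have [ii sp kp] := hs.
have [X1 [P [j [q [hP ht]]]]] := proj_ses X; have [ij sq kq] := ht.
have [q' q'E] := hP _ _ p q sp.
(* The horseshoe construction: the first [P] covers [X] as quotient of [F], the second covers it as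
   submodule. *)
pose w : {linear (P * P)%type -> F} := lcopair q' (lcomp i q).
have sw : surjective w.
  move=> f; have [a ha] := sq (p f).
  have [x hx] : exists x, i x = f - q' a by apply/kp; rewrite linearB q'E ha subrr.
  have [b hb] := sq x; exists (a, b); by rewrite /= hb hx addrC subrK.
have [F1 [v hv]] := ker_ex sw; have [iv _ kv] := hv.
have [i1 i1E] : exists i1 : {linear X1 -> F1}, forall x, v (i1 x) = lpair (lzero _ P) j x.
  apply: factor_inj iv _ => x; apply/kv => /=.
  by rewrite (ses0 x ht) !linear0 addr0.
have vE y : q' (v y).1 + i (q (v y).2) = 0 by apply: (ses0 y hv).
have [p1 p1E] : exists p1 : {linear F1 -> X1}, forall x, j (p1 x) = lcomp (lfst _ _) v x.
  apply: factor_inj ij _ => y; apply/kq => /=.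
  by have := congr1 p (vE y); rewrite linearD q'E (ses0 _ hs) addr0 linear0.
have s1 : surjective p1.
  move=> x; have [z hz] : exists z, i z = - q' (j x).
    by apply/kp; rewrite linearN q'E (ses0 x ht) oppr0.
  have [b hb] := sq z.
  have [y hy] : exists y, v y = (j x, b) by apply/kv; rewrite /= hb hz subrr.
  by exists y; apply: ij; rewrite p1E /= hy.
have hs1 : ses i1 p1.
  split=> //.
    by move=> x y /(congr1 v); rewrite !i1E /= => -[/ij].
  move=> y; split=> [hy|[x <-]].
    have y1 : (v y).1 = 0 by have := p1E y; rewrite hy linear0.
    have [x hx] : exists x, j x = (v y).2.
      apply/kq; apply: ii; have := vE y; rewrite y1 !linear0 add0r => ->.
      by [].
    by exists x; apply: iv; rewrite i1E /= hx -y1 -surjective_pairing.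
  by apply: ij; rewrite p1E /= i1E linear0.
have dP : baer (dual E (P * P)%type).
  by apply: eflat_dual_baer => //; apply: proj_eflat; apply: pair_projective.
have d1 := dual_baer_ker bE dF hv dP.
have pF1 : pd k F1 by apply: pF hv; apply: pair_projective.
have [|L1 [A1 [l1 [a1 [hA1 hs2 o1]]]]] := IH X1 F1 i1 p1 hs1 d1 pF1.
  (* Ext^1(X, dual E N) vanishes, because of [hC] and Ext^1(F, dual E N) = 0; so [g] extends along
     [j] to a map [e] on [P], which is then composed with the second component of [v]. *)
  move=> N fN g.
  have [u uE] := dual_baer_extend bE (lcomp g p1) dF hv.
  pose u1 := lcomp u (lpair (lid P) (lzero P P)).
  pose u2 := lcomp u (lpair (lzero P P) (lid P)).
  have u12 a b : u (a, b) = u1 a + u2 b.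
    rewrite /= -linearD; congr (u _).
    by change ((a, b) = (a + 0, 0 + b)); rewrite addr0 add0r.
  have [u' u'E] : exists u' : {linear X -> dual E N}, forall x, u' (q x) = u2 x.
    apply: factor_ses ht _ => x /=.
    have -> : (0, j x) = v (i1 x) by rewrite i1E.
    rewrite uE /= (_ : p1 (i1 x) = 0) ?linear0 //; exact: ses0 hs1.
  have [u'' u''E] := hC N fN u'.
  pose e := lsub u1 (lcomp u'' q').
  have eE x : e (j x) = g x.
    have [y hy] := s1 x.
    have vy : v y = (j x, (v y).2).
      by rewrite -hy p1E /= -surjective_pairing.
    have <- : u (v y) = g x by rewrite uE /= hy.
    rewrite [in RHS]vy u12 /e [LHS]/=; congr (_ + _).
    rewrite -u'E -u''E -linearN; congr (u'' _).
    by have := vE y; rewrite vy /= => /eqP; rewrite addr_eq0 => /eqP ->; rewrite opprK.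
  exists (lcomp e (lcomp (lsnd _ _) v)) => x.
  rewrite -eE; exact: (congr1 (fun z : P * P => e z.2) (i1E x)).
have [Q1 [ia [pa hA]]] := hA1; have [hQ1 hsa hpa] := hA.
have [iia spa kpa] := hsa; have [il1 sa1 ka1] := hs2.
have [be beE] := hpa _ hP (lcomp j a1).
have [al alE] : exists al : {linear A1 -> X}, forall x, al (pa x) = lcomp q be x.
  by apply: factor_ses hsa _ => z; rewrite /= beE /= (ses0 _ ht).
pose a : {linear (A1 * P)%type -> X} := lcopair al q.
have sa : surjective a.
  by move=> x; have [b hb] := sq x; exists (0, b); rewrite /= linear0 add0r.
have [L [l hl]] := ker_ex sa; have [il _ kl] := hl.
exists L, (A1 * P)%type, l, a; split=> //.
  exact: sgp_pair hA1 (proj_sgp hP).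
have [ka kaE] : exists ka : {linear Q1 -> L}, forall g, l (ka g) = lsub (lpair pa (lzero _ P)) (lpair (lzero _ A1) be) g.
  apply: factor_inj il _ => g; apply/kl => /=.
  by rewrite subr0 sub0r alE /= linearN subrr.
have kaE' g : l (ka g) = (pa g, - be g).
  by rewrite kaE /=; change ((pa g - 0, 0 - be g) = (pa g, - be g)); rewrite subr0 sub0r.
have hL : ses (lcomp ia l1) ka.
  split.
  - by move=> x y /= /iia/il1.
  - move=> y; have [g hg] := spa (l y).1.
    have := ses0 y hl; rewrite /= -hg alE /= -linearD => /kq[x hx].
    have [z hz] := sa1 x; exists (g - ia z); apply: il.
    rewrite kaE' !linearB (ses0 _ hsa) subr0 hg beE /= hz hx opprK.
    by rewrite addKr -surjective_pairing.
  - move=> g; split=> [hg|[x <-]].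
      have := kaE' g; rewrite hg linear0 => -[/esym/kpa[z hz] /esym/eqP].
      rewrite oppr_eq0 -hz beE /= => /eqP jz.
      have /ka1[x hx] : a1 z = 0 by apply: ij; rewrite jz linear0.
      by exists x; rewrite /= hx.
    apply: il; rewrite kaE' /= (ses0 _ hsa) beE /= (ses0 _ hs2) linear0 oppr0.
    by rewrite linear0.
move=> A' Q' i' p' hA'; have [hQ' hs' hp'] := hA'.
exact: (hext_quot hQ' hs' hL (hp' _ hQ1) (o1 _ _ _ _ hA')).
Qed.

End Approximation.

(** * Small pure quotients *)

Section LinearRelations.
Variable R : comPzRingType.

Lemma leval_cat (A : lmodType R) (s t : seq (R * A)) :
  leval (s ++ t) = leval s + leval t.
Proof. by rewrite /leval big_cat. Qed.

Lemma leval_cons (A : lmodType R) p (s : seq (R * A)) :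
  leval (p :: s) = p.1 *: p.2 + leval s.
Proof. by rewrite /leval big_cons. Qed.

Lemma leval_nil (A : lmodType R) : leval ([::] : seq (R * A)) = 0.
Proof. by rewrite /leval big_nil. Qed.

Lemma leval_lin (A B : lmodType R) (h : {linear A -> B}) (s : seq (R * A)) :
  leval (lsubst h s) = h (leval s).
Proof.
elim: s => [|p s IH]; first by rewrite /= !leval_nil linear0.
by rewrite /= !leval_cons IH linearD lin_scale.
Qed.

Lemma lsubst_cons (A B : Type) (r : A -> B) p (s : seq (R * A)) :
  lsubst r (p :: s) = (p.1, r p.2) :: lsubst r s.
Proof. by []. Qed.

Lemma lsubst_id (A : Type) (s : seq (R * A)) : lsubst id s = s.
Proof. by rewrite -[RHS]map_id; apply: eq_map => -[]. Qed.

Lemma lsubst_comp (A B C : Type) (r : B -> C) (t : A -> B) (s : seq (R * A)) :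
  lsubst r (lsubst t s) = lsubst (r \o t) s.
Proof. by rewrite /lsubst -map_comp. Qed.

Lemma leval_opp (T : finType) (A : Type) (N : lmodType R) (h : A -> N)
    (a : T -> R) (g : T -> A) :
  leval (lsubst h [seq (- a t, g t) | t <- enum T]) = - \sum_t a t *: h (g t).
Proof.
rewrite /leval /lsubst -map_comp big_map big_enum -sumrN.
by apply: eq_bigr => t _; rewrite /= scaleNr.
Qed.

Definition levalE := (lsubst_cons, leval_cons, leval_nil).

End LinearRelations.

(** The choice depends on [P] and [t0] only, so a recursive function can interpret a description by
    one fixed realization. *)
Definition pick_fun (I T : Type) (P : (I -> T) -> Prop) (t0 : T) : I -> T :=
  match pselect (exists v, P v) with
  | left h => projT1 (cid h)
  | right _ => fun=> t0
  end.

Lemma pick_funP (I T : Type) (P : (I -> T) -> Prop) (t0 : T) v :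
  P v -> P (pick_fun P t0).
Proof.
rewrite /pick_fun => hv; case: pselect => [h|n]; last by case: n; exists v.
exact: (projT2 (cid h)).
Qed.

(** * Terms and codes *)

Section Codes.
Variables (R : comPzRingType) (M : lmodType R).

(* A [skolem_type] is a positive type in countably many unknowns; [sk_cst] marks
   the unknowns whose values are prescribed.  Interpreting [sk_sol] by a chosen
   realization, the values of all terms of [skolem] over a point [q] form an
   elementary submodule containing [q], of a size depending only on [R]. *)
Record skolem_type := SkolemType {
  sk_rel : seq (R * nat) -> Prop;
  sk_diff : nat -> nat -> Prop;
  sk_in : nat -> Prop;
  sk_cst : nat -> Prop }.

Inductive skolem :=
| sk_root
| sk_sol of skolem_type & (nat -> skolem) & nat.

(* The diagram of such a submodule; [dg_cst] marks the elements to be kept fixed.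
   The values of [code] are closed under realizing every diagram over them, and
   the inductive type [code], which depends only on [R] and [M], plays the role
   of a cardinality bound. *)
Record diagram_type := DiagramType {
  dg_rel : seq (R * skolem) -> Prop;
  dg_diff : skolem -> skolem -> Prop;
  dg_val : skolem -> M -> Prop;
  dg_cst : skolem -> Prop }.

Inductive code :=
| code0
| code_at of diagram_type & (skolem -> code) & skolem.

End Codes.
Arguments sk_root {R}.
Arguments code0 {R M}.

(** * Differences between an elementary submodule and its copy *)

Section GoodSubmodules.
Variable R : comPzRingType.
Implicit Types A F K M Q X : lmodType R.

Definition pure_in A (P : A -> Prop) :=
  forall rels : seq (seq (R * A)), (forall s, s \in rels -> leval s = 0) ->
    exists r : A -> A, [/\ forall x, P (r x), forall x, P x -> r x = x &
      forall s, s \in rels -> leval (lsubst r s) = 0].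

Lemma pure_in_pure K A (P : A -> Prop) (j : {linear K -> A}) :
  injective j -> (forall x, P x <-> exists y, j y = x) -> pure_in P -> pure j.
Proof.
move=> ij jP pP rels /pP[r [rP rx hr]].
have [r' r'E] := @choice A K (fun x k => j k = r x) (fun x => (jP _).1 (rP x)).
exists r' => [k|s hs]; first by apply: ij; rewrite r'E rx //; apply/jP; exists k.
apply: ij; rewrite -leval_lin linear0 -[RHS](hr _ hs); congr leval.
by rewrite /lsubst -map_comp; apply: eq_map => p /=; rewrite r'E.
Qed.

(* The conditions on a submodule S of F which make S and its preimage in X the
   terms of a pair whose quotients again form an exact sequence X -> F -> X. *)
Definition good X F (i : {linear X -> F}) (p : {linear F -> X}) M (f : {linear X -> M})
    (S : F -> Prop) :=
  [/\ submod S,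
      (forall x, S x -> S (i (p x))) /\
      (forall x, S x -> i (p x) = 0 -> exists2 y, S y & i (p y) = x),
      (forall (T : finType) (a : T -> R) (q : T -> F), S (\sum_t a t *: q t) ->
        exists2 q' : T -> F, (forall t, S (q' t)) &
           \sum_t a t *: q' t = \sum_t a t *: q t),
      pure_in (fun x => S (i x)) &
      forall x, S (i x) -> f x = 0].

Section SmallStep.
Variables (X F M : lmodType R) (i : {linear X -> F}) (p : {linear F -> X})
  (f : {linear X -> M}).
Hypothesis hs : ses i p.

Local Notation diff x := (i (p x)).

Definition dg_sat (t : diagram_type M) (c e : skolem R -> F) :=
  [/\ forall s, dg_rel t s -> leval (lsubst e s) = 0,
      forall l l', dg_diff t l l' -> e l = diff (e l'),
      forall l m, dg_val t l m -> exists2 x, i x = e l & f x = m &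
      forall l, dg_cst t l -> e l = c l].

Fixpoint decode (w : code M) : F :=
  match w with
  | code0 => 0
  | code_at t c l => pick_fun (dg_sat t (fun l' => decode (c l'))) 0 l
  end.

Let B x := exists w, decode w = x.

(** Membership in [B] is part of the type: the elementary submodule must contain enough elements
    that the copy will fix. *)
Definition sk_sat (t : skolem_type R) (c v : nat -> F) :=
  [/\ forall s, sk_rel t s -> leval (lsubst v s) = 0,
      forall j k, sk_diff t j k -> v j = diff (v k),
      forall j, sk_in t j -> B (v j) &
      forall j, sk_cst t j -> v j = c j].

Section Point.
Variable q : F.

Fixpoint skval (l : skolem R) : F :=
  match l with
  | sk_root => q
  | sk_sol t c k => pick_fun (sk_sat t (fun j => skval (c j))) 0 k
  end.

Let D x := exists l, skval l = x.

Lemma skval_elementary (els : seq F) : exists r : F -> F,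
  [/\ forall x, D (r x), forall x, D x -> r x = x,
      forall s : seq (R * F), {subset [seq z.2 | z <- s] <= els} -> leval s = 0 ->
        leval (lsubst r s) = 0,
      forall x, x \in els -> diff x \in els -> r (diff x) = diff (r x) &
      forall x, x \in els -> B x -> B (r x)].
Proof.
pose v := nth 0 els.
pose t := SkolemType (fun s => leval (lsubst v s) = 0)
  (fun j k => v j = diff (v k)) (fun j => B (v j)) (fun j => D (v j)).
have [c cP] : exists c : nat -> skolem R, forall j, D (v j) -> skval (c j) = v j.
  apply: (@dep_choice nat (fun=> skolem R) (fun j l => D (v j) -> skval l = v j)) => j.
  have [[l hl]|n] := pselect (D (v j)); first by exists l.
  by exists sk_root.
pose v' k := skval (sk_sol t c k).
have [] : sk_sat t (fun j => skval (c j)) v'.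
  have hv : sk_sat t (fun j => skval (c j)) v by split=> // j /cP.
  exact: pick_funP hv.
move=> h1 h2 h3 h4.
pose r (x : F) : F := if pselect (D x) then x else v' (index x els).
exists r.
have rE x : x \in els -> r x = v' (index x els).
  move=> xe; rewrite /r; case: pselect => // Dx.
  have Dv : D (v (index x els)) by rewrite /v nth_index.
  by rewrite h4 // cP // /v nth_index.
split.
- by move=> x; rewrite /r; case: pselect => [//|nD]; exists (sk_sol t c (index x els)).
- by move=> x Dx; rewrite /r; case: pselect.
- move=> s se s0.
  have -> : lsubst r s = lsubst v' [seq (z.1, index z.2 els) | z <- s].
    rewrite /lsubst -map_comp; apply/eq_in_map => z zs /=.
    by rewrite rE // se //; apply: map_f.
  apply: h1; rewrite /= -[RHS]s0; congr leval.
  rewrite /lsubst -map_comp -[RHS]map_id; apply/eq_in_map => -[a x] zs /=.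
  by rewrite /v nth_index // se //; apply: (map_f snd zs).
- move=> x xe de; rewrite !rE //; apply: h2; rewrite /= /v !nth_index //.
- by move=> x xe Bx; rewrite rE //; apply: h3; rewrite /= /v nth_index.
Qed.

Let dg : diagram_type M := DiagramType (fun s => leval (lsubst skval s) = 0)
  (fun l l' => skval l = diff (skval l'))
  (fun l m => exists2 x, i x = skval l & f x = m) (fun l => B (skval l)).

(** The diagram of all of [D] is realized by [skval], so [decode] picks a realization, with values
    in [B]. The images under [f] belong to the diagram, which makes the copy one over [M]. *)
Lemma skval_copy : exists e' : skolem R -> F,
  [/\ forall l, B (e' l),
      forall s, leval (lsubst skval s) = 0 -> leval (lsubst e' s) = 0,
      forall l l', skval l = diff (skval l') -> e' l = diff (e' l'),
      forall l x, i x = skval l -> exists2 y, i y = e' l & f y = f x &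
      forall l, B (skval l) -> e' l = skval l].
Proof.
have [c cP] : exists c : skolem R -> code M, forall l, B (skval l) -> decode (c l) = skval l.
  apply: (@dep_choice (skolem R) (fun=> code M) (fun l w => B (skval l) -> decode w = skval l)) => l.
  have [[w hw]|n] := pselect (B (skval l)); first by exists w.
  by exists code0.
pose e' l := decode (code_at dg c l).
have [] : dg_sat dg (fun l => decode (c l)) e'.
  have he : dg_sat dg (fun l => decode (c l)) skval by split=> // l /cP.
  exact: pick_funP he.
move=> h1 h2 h3 h4; exists e'; split=> //.
- by move=> l; eexists.
- by move=> l x xl; apply: h3; exists x.
- by move=> l Bl; rewrite h4 // cP.
Qed.

(* [S] consists of the differences between the elements of an elementary
   submodule and those of a copy of it with values in [B]; it inherits each of
   the conditions of [good] because equations can be solved modulo [B]. *)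
Lemma good_step : exists S y, [/\ good i p f S, B y & S (q - y)].
Proof.
have [e' [eB erel ediff eval ecst]] := skval_copy.
pose e := skval.
have [ii sp kp] := hs.
have Dsum (T : finType) (a : T -> R) (g : T -> skolem R) :
    exists l, e l = \sum_t a t *: e (g t).
  set u := \sum_t _.
  pose els := u :: [seq e (g t) | t <- enum T].
  have [r [rD rx rrel _ _]] := skval_elementary els.
  suff <- : r u = u by apply: rD.
  have esub : {subset [seq z.2 | z <- (1, u) :: [seq (- a t, e (g t)) | t <- enum T]] <= els}.
    by rewrite /= -map_comp => z; rewrite !inE.
  have s0 : leval ((1, u) :: [seq (- a t, e (g t)) | t <- enum T]) = 0.
    by rewrite levalE scale1r -[X in leval X]lsubst_id leval_opp subrr.
  have := rrel _ esub s0; rewrite !levalE scale1r leval_opp /=.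
  have -> : \sum_t a t *: r (e (g t)) = u.
    by apply: eq_bigr => t _; rewrite rx //; exists (g t).
  by move/eqP; rewrite subr_eq0 => /eqP.
have esum (T : finType) (a : T -> R) (g : T -> skolem R) l :
    e l = \sum_t a t *: e (g t) -> e' l = \sum_t a t *: e' (g t).
  move=> el; have := erel ((1, l) :: [seq (- a t, g t) | t <- enum T]).
  rewrite !levalE !scale1r !leval_opp /= -/e el subrr => /(_ erefl)/eqP.
  by rewrite subr_eq0 => /eqP.
have ecomb a b l l' l'' : e l'' = a *: e l + b *: e l' -> e' l'' = a *: e' l + b *: e' l'.
  move=> h; have := esum bool (fun t => if t then a else b) (fun t => if t then l else l') l''.
  by rewrite !big_bool; apply.
have Dcomb a b l l' : exists l'', e l'' = a *: e l + b *: e l'.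
  have := Dsum bool (fun t => if t then a else b) (fun t => if t then l else l').
  by rewrite !big_bool.
have Dsub l l' : exists2 l'', e l'' = e l - e l' & e' l'' = e' l - e' l'.
  have [l'' h] := Dcomb 1 (-1) l l'; exists l''; move: (h); last move/ecomb.
    by rewrite scale1r scaleN1r.
  by rewrite scale1r scaleN1r.
have Ddiff l : exists2 l', e l' = diff (e l) & e' l' = diff (e' l).
  have [r [rD rx _ rd _]] := skval_elementary [:: e l; diff (e l)].
  have := rd (e l); rewrite !inE !eqxx orbT => /(_ isT isT).
  rewrite (rx (e l)); last by exists l.
  by move=> h; have [l' hl'] := rD (diff (e l)); rewrite h in hl'; exists l' => //; apply: ediff.
pose S x := exists l, x = e l - e' l.
(* [e' l] has the same differential as some [e l3] in both [D] and [B]. The copy fixes [e l3], so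
   replacing [l] by a term for [e l - e l3] leaves the difference unchanged. *)
have kerS x : S x -> diff x = 0 -> exists2 l, x = e l - e' l & diff (e l) = 0.
  move=> [l ->]; rewrite !linearB => /eqP; rewrite subr_eq0 => /eqP dl.
  have [l2 e2 e2'] := Ddiff l.
  have [r [rD rx _ rd rB]] := skval_elementary [:: e' l; diff (e' l)].
  have := rd (e' l); rewrite !inE !eqxx orbT => /(_ isT isT).
  rewrite (rx (diff (e' l))); last by exists l2; rewrite -/e e2 dl.
  have := rB (e' l); rewrite !inE eqxx => /(_ isT (eB l)) Br.
  have [l3 e3] := rD (e' l); rewrite -e3 in Br * => d3.
  have [l4 e4 e4'] := Dsub l l3; exists l4; first by rewrite e4 e4' (ecst l3 Br) opprB addrA subrK.
  by rewrite e4 !linearB /= -[e l3]/(skval l3) -d3 dl subrr.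
have imD l : diff (e l) = 0 -> exists l', e l = diff (e l').
  rewrite -{1}(linear0 i) => /ii/kp[x hx]; have [y hy] := sp x.
  have [r [rD rx _ rd _]] := skval_elementary [:: y; diff y].
  have := rd y; rewrite !inE !eqxx orbT => /(_ isT isT).
  rewrite rx; last by exists l; rewrite -/e hy.
  by move=> h; have [l' hl'] := rD y; exists l'; rewrite -hx -hy h -hl'.
have Bfix l : B (e l) -> e' l = e l by apply: ecst.
exists S, (e' sk_root); split; [split|exact: eB|by exists sk_root].
- split.
    have [l hl _] := Dsub sk_root sk_root; exists l.
    have := ecomb 0 0 l l l; rewrite !scale0r addr0 hl subrr => -> //.
    by rewrite subr0.
  move=> a _ _ [l ->] [l' ->]; have [l'' h] := Dcomb a 1 l l'; exists l''.
  rewrite (ecomb _ _ _ _ _ h) h !scale1r scalerBr opprD.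
  by rewrite addrACA.
- split=> [_ [l ->]|x Sx dx].
    by have [l' h h'] := Ddiff l; exists l'; rewrite h h' !linearB.
  have [l -> dl] := kerS x Sx dx; have [l' hl'] := imD l dl.
  exists (e l' - e' l'); first by exists l'.
  by rewrite !linearB -hl' (ediff _ _ hl').
- move=> T a g [l hl].
  (* [r] moves the solution into [D] and [e' l] to an element of [D] and [B]. The copy fixes the
     latter, so the solved equation minus its copy has the original left-hand side. *)
  pose els := [:: e l; e' l] ++ [seq g t | t <- enum T].
  have [r [rD rx rrel _ rB]] := skval_elementary els.
  have [k kE] := @choice T _ (fun t l => e l = r (g t)) (fun t => rD (g t)).
  have [l6 h6] := rD (e' l).
  have B6 : B (e l6) by rewrite /e h6; apply: rB (eB l); rewrite !inE eqxx orbT.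
  pose s := (1, e l) :: (-1, e' l) :: [seq (- a t, g t) | t <- enum T].
  have ssub : {subset [seq z.2 | z <- s] <= els}.
    by rewrite /= -map_comp => z; rewrite !inE.
  have lsum (h : F -> F) : leval (lsubst h s) = h (e l) - h (e' l) - \sum_t a t *: h (g t).
    by rewrite !levalE scale1r scaleN1r leval_opp addrA.
  have s0 : leval s = 0 by rewrite -[s]lsubst_id lsum hl subrr.
  have := rrel s ssub s0; rewrite lsum (rx (e l)); last by exists l.
  rewrite -h6 => /eqP; rewrite subr_eq0 => /eqP h.
  have [l7 h7 h7'] := Dsub l l6.
  exists (fun t => e (k t) - e' (k t)); first by move=> t; exists (k t).
  rewrite hl; transitivity (e l7 - e' l7).
    under eq_bigr => t _ do rewrite scalerBr.
    rewrite sumrB -(esum _ _ _ l7).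
      by rewrite h7 h; congr (_ - _); apply: eq_bigr => t _; rewrite kE.
    by rewrite h7 h; apply: eq_bigr => t _; rewrite kE.
  by rewrite h7 h7' (Bfix _ B6) opprB addrA subrK.
- move=> rels hrels.
  pose elsX := flatten [seq [seq z.2 | z <- s] | s <- rels].
  have memX s z : s \in rels -> z \in s -> z.2 \in elsX.
    move=> sr zs; apply/flattenP; exists [seq z.2 | z <- s]; first exact: map_f.
    exact: map_f.
  have [g gP] : exists g : X -> skolem R, forall a, S (i a) -> i a = e (g a) - e' (g a).
    apply: (@dep_choice X (fun=> skolem R) (fun a l => S (i a) -> i a = e l - e' l)) => a.
    by have [[l hl]|n] := pselect (S (i a)); [exists l|exists sk_root].
  (* With [0] listed, [r] keeps [i a] in the kernel of the differential; the other two entries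
     preserve the decomposition of those [i a] that already lie in [S]. *)
  pose els := 0 :: flatten [seq [:: i a; e (g a); e' (g a)] | a <- elsX].
  have memF a z : a \in elsX -> z \in [:: i a; e (g a); e' (g a)] -> z \in els.
    move=> ax zx; rewrite inE; apply/orP; right; apply/flattenP.
    by exists [:: i a; e (g a); e' (g a)] => //; apply/mapP; exists a.
  have [r [rD rx rrel rd rB]] := skval_elementary els.
  have D0 : D 0.
    by have [l hl _] := Dsub sk_root sk_root; exists l; rewrite -/e hl subrr.
  have [rX rXP] : exists rX : X -> X * skolem R, forall a,
    [/\ S (i (rX a).1), S (i a) -> (rX a).1 = a & a \in elsX ->
        e (rX a).2 = r (i a) /\ i (rX a).1 = e (rX a).2 - e' (rX a).2].
    apply: (@dep_choice X (fun=> (X * skolem R)%type) (fun a b => [/\ S (i b.1), S (i a) -> b.1 = a & a \in elsX ->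
        e b.2 = r (i a) /\ i b.1 = e b.2 - e' b.2])) => a.
    have S0 : S (i 0).
      have [l hl hl'] := Dsub sk_root sk_root.
      by exists l; rewrite hl hl' !subrr linear0.
    have [aX|aX] := boolP (a \in elsX); last first.
      by have [Sa|nS] := pselect (S (i a)); [exists (a, sk_root)|exists (0, sk_root)].
    have [m hm] := rD (i a).
    have [Sa|nS] := pselect (S (i a)).
      exists (a, m); split=> // _; split=> //=.
      have [l6 h6] := rD (e' (g a)).
      have B6 : B (e l6).
        by rewrite /e h6; apply: rB (eB _); apply: (memF a) => //; rewrite !inE eqxx !orbT.
      have := rrel [:: (1, i a); (-1, e (g a)); (1, e' (g a))].
      rewrite !levalE /= !scale1r !scaleN1r !addr0 (rx (e (g a))); last by exists (g a).
      rewrite -h6 -hm => h; have /h{h} : {subset [:: i a; e (g a); e' (g a)] <= els}.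
        by move=> z; apply: memF.
      have h0 : i a + (- e (g a) + e' (g a)) = 0.
        by rewrite [X in _ + X]addrC -opprB -gP // subrr.
      move=> /(_ h0) h.
      have hm' : e m = e (g a) - e l6.
        by apply/eqP; rewrite -subr_eq0 opprB [e l6 - _]addrC h.
      have -> : e' m = e' (g a) - e l6.
        have := ecomb 1 (-1) (g a) l6 m; rewrite !scale1r !scaleN1r (Bfix _ B6).
        by apply.
      by rewrite hm' opprB addrA subrK gP.
    have dm : diff (e m) = 0.
      have d0 : diff (i a) = 0 by rewrite (ses0 _ hs) linear0.
      rewrite /e hm -rd ?d0 ?rx //; last by rewrite inE eqxx.
      by apply: (memF a) => //; rewrite inE eqxx.
    have [a' ha'] : exists a', i a' = e m - e' m.
      apply/kp; apply: ii; rewrite linear0 !linearB dm.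
      have [l2 h2 h2'] := Ddiff m; rewrite -h2' sub0r.
      have := ecomb 0 0 l2 l2 l2; rewrite !scale0r addr0 h2 dm => -> //.
      by rewrite oppr0.
    by exists (a', m); split=> //=; exists m.
  exists (fun a => (rX a).1); split=> [a|a Sa|s sr].
  - by have [] := rXP a.
  - by have [_ h _] := rXP a; apply: h.
  apply: ii; rewrite linear0 -leval_lin.
  have s0 := hrels s sr.
  have h1 : leval (lsubst (fun a => e (rX a).2) s) = 0.
    have := rrel (lsubst i s).
    rewrite leval_lin s0 linear0 => h; rewrite -[RHS]h //.
      rewrite /lsubst -map_comp; congr leval; apply/eq_in_map => z zs /=.
      by have [_ _ /(_ (memX _ _ sr zs))[-> _]] := rXP z.2.
    rewrite /lsubst -map_comp => z /mapP[y ys ->].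
    by apply: memF (memX _ _ sr ys) _; rewrite inE eqxx.
  have h2 : leval (lsubst (fun a => e' (rX a).2) s) = 0.
    have := erel (lsubst (fun a => (rX a).2) s).
    rewrite /lsubst -!map_comp; apply; exact: h1.
  have -> : leval (lsubst i (lsubst (fun a => (rX a).1) s)) =
    leval (lsubst (fun a => e (rX a).2) s) - leval (lsubst (fun a => e' (rX a).2) s).
    rewrite /leval /lsubst !big_map -sumrB; apply: eq_big_seq => z zs /=.
    by have [_ _ /(_ (memX _ _ sr zs))[_ ->]] := rXP z.2; rewrite scalerBr.
  by rewrite h1 h2 subrr.
- move=> a Sa; have da : diff (i a) = 0 by rewrite (ses0 _ hs) linear0.
  have [l hl dl] := kerS _ Sa da.
  have [x hx] : exists x, i x = e l by apply/kp/ii; rewrite linear0.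
  have [y hy fy] := eval l x hx.
  have -> : a = x - y by apply: ii; rewrite linearB hx hy.
  by rewrite linearB fy subrr.
Qed.

End Point.
End SmallStep.
End GoodSubmodules.

(** * Quotients by maximal good submodules *)

Section Quotients.
Variable R : comPzRingType.
Implicit Types A F K M N Q X : lmodType R.

Lemma good_maximal A Q M (i : {linear A -> Q}) (p : {linear Q -> A}) (f : {linear A -> M}) :
  ses i p -> exists2 S : Q -> Prop, good i p f S &
    forall S' : Q -> Prop, good i p f S' -> (forall x, S x -> S' x) -> forall x, S' x -> S x.
Proof.
move=> hs; have [ii sp kp] := hs.
have [||S [_ gS mS]] := @zorn_above Q (fun x => x = 0) (good i p f); last by exists S.
  split.
  - by split=> // a _ _ -> ->; rewrite scaler0 addr0.
  - split=> [_ ->|_ -> _]; first by rewrite !linear0.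
    by exists 0; rewrite ?linear0.
  - move=> T a q ->; exists (fun _ => 0) => //.
    by rewrite big1 // => t _; rewrite scaler0.
  - move=> rels _; exists (fun _ => 0); split=> [x|x|s _].
    + exact: linear0.
    + by rewrite -{1}(linear0 i) => /ii.
    + by rewrite /leval big_map big1 // => z _; rewrite scaler0.
  - by move=> x; rewrite -{1}(linear0 i) => /ii ->; rewrite linear0.
move=> C [G0 CG0] Cgood Ctot.
have two x y : (exists2 G, C G & G x) -> (exists2 G, C G & G y) ->
    exists G, [/\ C G, G x & G y].
  move=> [G CG Gx] [H CH Hy]; have [h|h] := Ctot _ _ CG CH.
    by exists H; split=> //; apply: h.
  by exists G; split=> //; apply: h.
split.
- split; first by exists G0 => //; have [[]] := Cgood _ CG0.
  move=> a x y /two h /h[G [CG Gx Gy]]; exists G => //.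
  by have [[_ c] _ _ _ _] := Cgood _ CG; apply: c.
- split=> [x [G CG Gx]|x [G CG Gx] dx].
    by exists G => //; have [_ [c _] _ _ _] := Cgood _ CG; apply: c.
  have [_ [_ c] _ _ _] := Cgood _ CG; have [y Gy yx] := c x Gx dx.
  by exists y => //; exists G.
- move=> T a q [G CG Gx]; have [_ _ c _ _] := Cgood _ CG.
  by have [q' Gq' e] := c _ _ _ Gx; exists q' => // t; exists G.
- move=> rels hr.
  pose els := flatten [seq [seq z.2 | z <- s] | s <- rels].
  have [G CG hG] : exists2 G, C G & forall x, x \in els -> (exists2 H, C H & H (i x)) -> G (i x).
    elim: els => [|x l [G CG hG]]; first by exists G0.
    have [[H CH Hx]|n] := pselect (exists2 H, C H & H (i x)); last first.
      by exists G => // y; rewrite inE => /orP[/eqP ->|/hG].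
    have [h|h] := Ctot _ _ CG CH.
      exists H => // y; rewrite inE => /orP[/eqP ->|/hG k] // /k; exact: h.
    by exists G => // y; rewrite inE => /orP[/eqP -> _|/hG k] //; apply: h.
  have [_ _ _ c _] := Cgood _ CG; have [r [rG rx rr]] := c rels hr.
  (* On the elements occurring in [rels] this is [r], since [G] was chosen large enough to contain
     those that belong to the union. *)
  exists (fun x => if pselect (exists2 H, C H & H (i x)) then x else r x); split.
  + by move=> x; case: pselect => [h|nh] /=; [exact: h|exists G => //; apply: rG].
  + by move=> x hx; case: pselect.
  + move=> s sr; rewrite -[RHS](rr _ sr); congr leval.
    apply/eq_in_map => z zs /=; case: pselect => // h; congr pair.
    rewrite rx //; apply: hG => //; apply/flattenP.
    by exists [seq z.2 | z <- s]; apply: map_f.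
- by move=> x [G CG Gx]; have [_ _ _ _ c] := Cgood _ CG; apply: c.
Qed.

Definition quotient_pair A Q X F (S : Q -> Prop) (i : {linear A -> Q}) (p : {linear Q -> A})
   (iF : {linear X -> F}) (pF : {linear F -> X}) (pQ : {linear Q -> F})
   (pA : {linear A -> X}) :=
  [/\ ses iF pF, surjective pQ /\ (forall x, pQ x = 0 <-> S x),
   surjective pA /\ (forall a, pA a = 0 <-> S (i a)),
   forall a, iF (pA a) = pQ (i a) & forall x, pF (pQ x) = pA (p x)].

Lemma good_quotient A Q M (i : {linear A -> Q}) (p : {linear Q -> A})
    (f : {linear A -> M}) S :
  ses i p -> good i p f S ->
  exists X F (iF : {linear X -> F}) (pF : {linear F -> X}) (pQ : {linear Q -> F})
   (pA : {linear A -> X}) (fX : {linear X -> M}),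
   quotient_pair S i p iF pF pQ pA /\ forall a, fX (pA a) = f a.
Proof.
move=> hs [hS [S1 S1'] _ _ S4]; have [ii sp kp] := hs.
have hSi : submod (fun a => S (i a)).
  split; first by rewrite linear0; apply: submod0 hS.
  by move=> a x y Sx Sy; rewrite linearP; case: hS => _; apply.
have [F [pQ [sQ kQ]]] := quot_ex hS.
have [X [pA [sA kA]]] := quot_ex hSi.
have [iF iFE] : exists iF : {linear X -> F}, forall a, iF (pA a) = lcomp pQ i a.
  by apply: factor_surj sA _ => a /kA Sa; apply/kQ.
have [pF pFE] : exists pF : {linear F -> X}, forall x, pF (pQ x) = lcomp pA p x.
  by apply: factor_surj sQ _ => x /kQ Sx; apply/kA/S1.
have [fX fXE] : exists fX : {linear X -> M}, forall a, fX (pA a) = f a.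
  by apply: factor_surj sA _ => a /kA; apply: S4.
exists X, F, iF, pF, pQ, pA, fX; split=> //; split=> //.
split.
- apply: lker0 => x; have [a <-] := sA x; rewrite iFE => /kQ Sa; exact/kA.
- move=> x; have [a <-] := sA x; have [y <-] := sp a; by exists (pQ y); rewrite pFE.
- move=> x; have [y <-] := sQ x; rewrite pFE /=; split=> [/kA Sy|[z]].
    have [u Su ue] := S1' _ Sy (etrans (congr1 i (ses0 _ hs)) (linear0 i)).
    have [a ha] : exists a, i a = y - u.
      by apply/kp; rewrite linearB (ii _ _ ue) subrr.
    exists (pA a); rewrite iFE /= ha linearB.
    by rewrite (iffRL (kQ u) Su) subr0.
  have [a <-] := sA z; rewrite iFE /= => h.
  have /kQ : pQ (y - i a) = 0 by rewrite linearB h subrr.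
  by move/S1; rewrite linearB (ses0 _ hs) subr0 => /kA.
Qed.

(** If [S] is maximal, this forces every good submodule of the quotient [F] to be zero. *)
Lemma good_pullback A Q M X F (i : {linear A -> Q}) (p : {linear Q -> A})
    (f : {linear A -> M}) S (iF : {linear X -> F}) (pF : {linear F -> X})
   (pQ : {linear Q -> F}) (pA : {linear A -> X}) (fX : {linear X -> M}) S' :
  ses i p -> good i p f S -> quotient_pair S i p iF pF pQ pA ->
  (forall a, fX (pA a) = f a) -> good iF pF fX S' -> good i p f (fun x => S' (pQ x)).
Proof.
move=> hs gS [hF [sQ kQ] [sA kA] iE pE] fE gS'.
have [hS [S1 S1'] S2 S3 S4] := gS.
have [hS' [S1F S1F'] S2F S3F S4F] := gS'.
have dE x : pQ (i (p x)) = iF (pF (pQ x)) by rewrite pE iE.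
split.
- split; first by rewrite linear0; apply: submod0 hS'.
  by move=> a x y Sx Sy; rewrite linearP; case: hS' => _; apply.
- split=> [x|x Sx dx]; first by rewrite dE; apply: S1F.
  have [|y Sy] := S1F' _ Sx; first by rewrite -dE dx linear0.
  have [z zy] := sQ y; rewrite -zy -dE => h.
  have Sxz : S (x - i (p z)) by apply/kQ; rewrite linearB h subrr.
  have [|u Su ue] := S1' _ Sxz; first by rewrite !linearB dx (ses0 _ hs) !linear0 addr0.
  exists (z + u); last by rewrite !linearD ue addrC subrK.
  by rewrite linearD (iffRL (kQ u) Su) addr0 zy.
- move=> T a q; rewrite linear_sum.
  under eq_bigr => t _ do rewrite lin_scale.
  case/S2F=> q' Sq' q'E.
  have [g gE] := @choice T Q (fun t x => pQ x = q' t) (fun t => sQ (q' t)).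
  have /S2[v Sv vE] : S (\sum_t a t *: (q t - g t)).
    apply/kQ; transitivity (\sum_t a t *: pQ (q t) - \sum_t a t *: q' t).
      rewrite linear_sum -sumrB; apply: eq_bigr => t _.
      by rewrite lin_scale linearB gE scalerBr.
    by rewrite q'E subrr.
  exists (fun t => g t + v t) => [t|].
    by rewrite linearD gE (iffRL (kQ _) (Sv t)) addr0.
  under eq_bigr => t _ do rewrite scalerDr.
  rewrite big_split /= vE -big_split /=; apply: eq_bigr => t _.
  by rewrite -scalerDr addrC subrK.
- move=> rels hr.
  have [|r [rP rx rr]] := S3F [seq lsubst pA s | s <- rels].
    by move=> _ /mapP[s sr ->]; rewrite leval_lin hr // linear0.
  have [u uP] : exists u : A -> A, forall a, pA (u a) = r (pA a) /\
      (S' (iF (pA a)) -> u a = a).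
    apply: (@dep_choice A (fun=> A) (fun a b => pA b = r (pA a) /\ (S' (iF (pA a)) -> b = a))) => a.
    have [Sa|n] := pselect (S' (iF (pA a))); first by exists a; rewrite rx.
    by have [b hb] := sA (r (pA a)); exists b.
  (* The lift [u] preserves a relation only up to an error [leval (lsubst u s)] in the kernel of
     [pA]. Purity of that kernel, applied to these relations, gives a [v] fixing the error, and
     adding [v (a - u a)] cancels it. *)
  pose rels' := [seq (1, leval (lsubst u s)) :: lsubst (fun a => a - u a) s | s <- rels].
  have lsumB s : leval (lsubst (fun a => a - u a) s) = leval s - leval (lsubst u s).
    by rewrite /leval /lsubst !big_map -sumrB; apply: eq_bigr => z _; rewrite scalerBr.
  have [|v [vP vx vr]] := S3 rels'.
    move=> _ /mapP[s sr ->]; rewrite leval_cons /= scale1r lsumB (hr s sr) sub0r.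
    by rewrite subrr.
  exists (fun a => u a + v (a - u a)); split=> [a|a|s sr].
  + rewrite -iE linearD (proj1 (uP a)) (iffRL (kA _) (vP _)) addr0; exact: rP.
  + rewrite -iE => Sa; rewrite (proj2 (uP a) Sa) subrr vx ?addr0 //.
    by rewrite linear0; apply: submod0 hS.
  + have Ss : S (i (leval (lsubst u s))).
      apply/kA; rewrite -leval_lin -[RHS](rr (lsubst pA s)); last exact: map_f.
      rewrite !lsubst_comp; congr leval; apply: eq_map => z /=.
      by rewrite (proj1 (uP _)).
    have := vr ((1, leval (lsubst u s)) :: lsubst (fun a => a - u a) s).
    rewrite leval_cons /= scale1r vx // => <-; last by apply/mapP; exists s.
    rewrite /leval /lsubst !big_map -big_split /=.
    by apply: eq_bigr => z _; rewrite scalerDr.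
- by move=> a; rewrite -iE => /S4F <-; rewrite fE.
Qed.

(** The good submodule given by [good_step] is zero in the quotient by a maximal [S], so each
    element of [F] is the value of a code. *)
Lemma small_quotient A Q M (i : {linear A -> Q}) (p : {linear Q -> A})
    (f : {linear A -> M}) : ses i p ->
  exists S X F (iF : {linear X -> F}) (pF : {linear F -> X}) (pQ : {linear Q -> F})
   (pA : {linear A -> X}) (fX : {linear X -> M}) (w : code M -> X),
   [/\ good i p f S, quotient_pair S i p iF pF pQ pA, forall a, fX (pA a) = f a &
      surjective w].
Proof.
move=> hs; have [S gS mS] := good_maximal f hs.
have [X [F [iF [pF [pQ [pA [fX [hq fE]]]]]]]] := good_quotient hs gS.
have [hF [sQ kQ] _ _ _] := hq; have [_ sF _] := hF.
exists S, X, F, iF, pF, pQ, pA, fX, (fun c => pF (decode iF pF fX c)).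
split=> // x; have [y <-] := sF x.
have [S' [z [gS' [c cz] Sz]]] := good_step fX hF y.
have gP := good_pullback hs gS hq fE gS'.
exists c; congr (pF _); rewrite cz; have [u hu] := sQ (y - z).
have /kQ : S u.
  apply: (mS _ gP) => [v /kQ ->|]; last by rewrite hu.
  by case: gS' => h _ _ _ _; apply: submod0 h.
by rewrite hu => /eqP; rewrite subr_eq0 => /eqP.
Qed.

End Quotients.

Section QuotientFlat.
Variables (R : comPzRingType) (E : lmodType R) (d : nat).
Hypothesis bE : baer E.
Hypothesis cogen : forall (M : lmodType R) (m : M), m <> 0 ->
    exists h : {linear M -> E}, h m <> 0.
Hypothesis hperf : perfect d R.
Implicit Types A F K M N Q X : lmodType R.

(** [F] is a pure quotient of a projective. A map from [X] to a flat dual, pulled back to [A],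
    extends to [Q] because that dual has finite projective dimension; the extension must then be
    made to vanish on [S]. *)
Lemma quotient_pair_flat A Q M X F (i : {linear A -> Q}) (p : {linear Q -> A})
    (f : {linear A -> M}) S (iF : {linear X -> F}) (pF : {linear F -> X})
   (pQ : {linear Q -> F}) (pA : {linear A -> X}) :
  sgp_data i p -> good i p f S -> quotient_pair S i p iF pF pQ pA ->
  eflat F /\ forall N, eflat (dual E N) -> hext iF (dual E N).
Proof.
move=> hA [hS [S1 S1'] S2 S3 S4] [hF [sQ kQ] [sA kA] iE pE].
have [hQ hs hp] := hA; have [ii sp kp] := hs.
split.
  apply: (quot_eflat (proj_eflat hQ) sQ) => T a q /kQ/S2[q' Sq' e].
  by exists q' => // t; apply/kQ.
move=> N fN g.
have [h hE] := sgp_hext_pd hA (eflat_pd bE cogen hperf fN) (lcomp g pA).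
have hSi : submod (fun a => S (i a)).
  split; first by rewrite linear0; apply: submod0 hS.
  by move=> a x y Sx Sy; rewrite linearP; case: hS => _; apply.
have [K [j [ij jP]]] := sub_ex hSi.
(* [h] vanishes on the elements of [S] in the image of [i], so on [S] it factors through [p]. The
   factor extends from the pure submodule [K] to a map [t] on [A], and [h - t p] descends to [F]. *)
pose G (k : K) (c : dual E N) := exists y, [/\ S y, p y = j k & c = h y].
have hG : linrel G.
  split.
  - by exists 0; rewrite !linear0; split=> //; apply: submod0 hS.
  - move=> a k _ k' _ [y [Sy yk ->]] [y' [Sy' yk' ->]]; exists (a *: y + y').
    by rewrite !linearP yk yk'; split=> //; case: hS => _; apply.
  - move=> c [y [Sy]]; rewrite linear0 => /kp[a ha ->].
    rewrite -ha hE /= (iffRL (kA a)) ?linear0 //; by rewrite ha.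
have [t0 t0E] := lin_of_rel hG (fun k => ltac:(
  have Sk := iffRL (jP (j k)) (ex_intro _ k erefl);
  have [y Sy ye] := S1' _ Sk (etrans (congr1 i (ses0 _ hs)) (linear0 i));
  by exists (h y), y; split=> //; apply: ii)).
have [t tE] := pure_dual_ext bE t0 (pure_in_pure ij jP S3).
have [h'' h''E] : exists h'' : {linear F -> dual E N},
    forall x, h'' (pQ x) = lsub h (lcomp t p) x.
  apply: factor_surj sQ _ => x /kQ Sx /=.
  have [k hk] := (jP (p x)).1 (S1 _ Sx).
  have Gk : G k (h x) by exists x.
  by rewrite -hk tE (linrel_fun hG (t0E k) Gk) subrr.
exists h'' => x; have [a <-] := sA x.
by rewrite iE h''E /= hE /= (ses0 _ hs) linear0 subr0.
Qed.

End QuotientFlat.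

(** * Gorenstein projective modules *)

Section GorensteinProjective.
Variable R : comPzRingType.
Implicit Types A F K M N Q X : lmodType R.

Lemma sgp_dsum J (A : J -> lmodType R) (D : lmodType R) (inc : forall j, {linear A j -> D})
   (pr : forall j, {linear D -> A j}) :
  (forall j x, pr j (inc j x) = x) ->
  (forall j k x, j <> k -> pr k (inc j x) = 0) ->
  (forall u v, (forall j, pr j u = pr j v) -> u = v) ->
  (forall u, exists2 s : seq {classic J}, uniq s &
         (forall j : {classic J}, j \notin s -> pr j u = 0)
         /\ u = \sum_(j <- s) inc j (pr j u)) ->
  (forall j, sgp (A j)) -> sgp D.
Proof.
move=> h1 h2 h3 h4 hA.
pose T j := {Q : lmodType R & ({linear A j -> Q} * {linear Q -> A j})%type}.
have [g gP] : exists g : forall j, T j, forall j, sgp_data (projT2 (g j)).1 (projT2 (g j)).2.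
  apply: (@dep_choice J T (fun j t => sgp_data (projT2 t).1 (projT2 t).2)) => j.
  have [Q [i [p h]]] := hA j.
  by exists (existT _ Q (i, p)).
pose Q j : lmodType R := projT1 (g j).
pose i j : {linear A j -> Q j} := (projT2 (g j)).1.
pose p j : {linear Q j -> A j} := (projT2 (g j)).2.
have hs j : ses (i j) (p j) by have [] := gP j.
have [DQ [incQ [prQ [q1 q2 q3 q4]]]] := dsum_ex Q.
have [I IE] := dsum_lift h1 h2 h4 (fun j => lcomp (incQ j) (i j)).
have [P PE] := dsum_lift q1 q2 q4 (fun j => lcomp (inc j) (p j)).
have prI j u : prQ j (I u) = i j (pr j u).
  apply: (dsum_eq h4 (f := lcomp (prQ j) I) (g := lcomp (i j) (pr j))) => k x /=.
  rewrite IE /=; have [e|n] := pselect (k = j); last by rewrite q2 // h2 // linear0.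
  by subst k; rewrite q1 h1.
have prP j u : pr j (P u) = p j (prQ j u).
  apply: (dsum_eq q4 (f := lcomp (pr j) P) (g := lcomp (p j) (prQ j))) => k x /=.
  rewrite PE /=; have [e|n] := pselect (k = j); last by rewrite q2 // h2 // linear0.
  by subst k; rewrite q1 h1.
exists DQ, I, P; split.
- by apply: dsum_projective q1 q2 q4 _ => j; have [] := gP j.
- split.
  + move=> u v e; apply: h3 => j; have [ij _ _] := hs j; apply: ij.
    by rewrite -!prI e.
  + move=> u; have [s us [_ ->]] := h4 u.
    have [y yE] := @dep_choice J Q (fun j y => p j y = pr j u)
      (fun j => ltac:(have [_ sp _] := hs j; exact: sp)).
    exists (\sum_(j <- s) incQ j (y j)); rewrite linear_sum; apply: eq_bigr => j _.
    by rewrite PE /= yE.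
  + move=> u; split=> [Pu|[y <-]]; last first.
      by apply: h3 => j; rewrite prP prI (ses0 _ (hs j)) linear0.
    have [x xE] := @dep_choice J A (fun j x => i j x = prQ j u)
      (fun j => ltac:(have [_ _ kp] := hs j; apply/kp; by rewrite -prP Pu linear0)).
    have [s us [_ ->]] := q4 u.
    exists (\sum_(j <- s) inc j (x j)); rewrite linear_sum; apply: eq_bigr => j _.
    by rewrite IE /= xE.
- move=> Y hY f.
  have [h hE] := @dep_choice J (fun j => {linear Q j -> Y}) (fun j h => forall x, h (i j x) = f (inc j x))
      (fun j => ltac:(have [_ _ e] := gP j; exact: e Y hY (lcomp f (inc j)))).
  have [H HE] := dsum_lift q1 q2 q4 h; exists H.
  apply: (dsum_eq h4 (f := lcomp H I) (g := f)) => j x.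
  by rewrite /= IE /= HE hE.
Qed.

Lemma sgp_gorenstein A : sgp A -> gorenstein_projective A.
Proof.
move=> [Q [i [p [hQ hs hp]]]]; have [ii sp kp] := hs.
pose C : complex R := @Complex R (fun _ => Q) (fun _ => lcomp i p)
  (fun n x => etrans (congr1 i (ses0 (p x) hs)) (linear0 i)).
exists C, 0; split; last first.
  exists i; split=> // x; rewrite -kp /=; split=> [h|->]; last exact: linear0.
  by apply: ii; rewrite linear0.
split=> //.
- move=> n x /= h; have /kp[y <-] : p x = 0 by apply: ii; rewrite h linear0.
  by have [z <-] := sp y; exists z.
- move=> Y hY n f hf; have [f' f'E] := @factor_ses _ _ _ _ _ i p f hs
    (fun y => ltac:(have [z <-] := sp y; exact: hf z)).
  have [g gE] := hp Y hY f'; exists g => x /=.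
  by rewrite gE f'E.
Qed.

(** The direct sum of all terms, with the total differential [dl], is exact of period one; a cycle
    module of one degree is a summand of its kernel. *)
Lemma gorenstein_retract (G : lmodType R) : gorenstein_projective G ->
  exists2 A : lmodType R, sgp A & retract G A.
Proof.
move=> [P [n0 [[projP acP homP] [j [ij jP]]]]].
have [D [inc [pr [h1 h2 h3 h4]]]] := dsum_ex P.
have dmk (f : forall k, P k) (s : seq {classic int}) :
    (forall k : {classic int}, k \notin s -> f k = 0) -> exists u, forall k, pr k u = f k.
  move=> hf; exists (\sum_(k <- undup s) inc k (f k)) => k; rewrite linear_sum.
  have [ks|ks] := boolP ((k : {classic int}) \in undup s).
    rewrite (bigD1_seq (k : {classic int})) ?undup_uniq //= h1 big1 ?addr0 //.
    by move=> l /eqP lk; rewrite h2.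
  rewrite big_seq big1; first by rewrite hf // -mem_undup.
  by move=> l ls; rewrite h2 // => e; rewrite -e ls in ks.
pose G' (u v : D) := forall n, pr n v = diff P n (pr (n + 1) u).
have [||dl dlE] := @lin_of_rel _ _ _ G'.
- split; first by move=> n; rewrite !linear0.
    by move=> a x y x' y' h h' n; rewrite !linearP h h'.
  by move=> y h; apply: h3 => n; rewrite h !linear0.
- move=> u; have [s us [hs _]] := h4 u.
  pose dn (k : {classic int}) : {classic int} := (k : int) - 1.
  apply: (dmk (fun n => diff P n (pr (n + 1) u)) [seq dn k | k <- s]) => k ks.
  rewrite hs ?linear0 //; apply: contra ks => ks.
  suff <- : dn ((k : int) + 1) = k by exact: (map_f dn ks).
  exact: (addrK (1 : int)).
have dl_inc n x : dl (inc (n + 1) x) = inc n (diff P n x).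
  apply: h3 => k; rewrite dlE; have [e|nk] := pselect (n = k).
    by subst k; rewrite !h1.
  by rewrite !h2 ?linear0 // => /addIr.
have shift (k : int) : exists n, k = n + 1 by exists (k - 1); rewrite subrK.
have dl2 u : dl (dl u) = 0 by apply: h3 => n; rewrite !dlE diffK linear0.
have [A [i [ii iP]]] := sub_ex (ker_submod dl).
have [p pE] : exists p : {linear D -> A}, forall u, i (p u) = dl u.
  by apply: factor_inj ii _ => u; apply/iP.
have sp : surjective p.
  move=> x; pose z := i x.
  have z0 n : diff P n (pr (n + 1) z) = 0.
    by rewrite -dlE (_ : dl z = 0) ?linear0 //; apply/iP; exists x.
  (* Preferring the preimage 0 wherever possible keeps the family finitely supported. *)
  have ex n : exists c : P (n + 1 + 1), diff P (n + 1) c = pr (n + 1) z /\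
      (pr (n + 1) z = 0 -> c = 0).
    have [e|ne] := pselect (pr (n + 1) z = 0); first by exists 0; rewrite linear0 e.
    by have [c hc] := acP n _ (z0 n); exists c.
  have [c cP] := dep_choice ex.
  (* The preimages are indexed by shifted degrees, which agree with [k] only up to a provable
     equality; hence the transport. *)
  have sh (k : int) : k - 1 - 1 + 1 + 1 = k by rewrite !subrK.
  pose y k : P k := ecast k (P k) (sh k) (c (k - 1 - 1)).
  have castE n m (e : m + 1 + 1 = n + 1 + 1) : ecast k (P k) e (c m) = c n.
    have em : m = n by apply: (addIr 1); apply: (addIr 1).
    by subst m; rewrite (eq_irrelevance e erefl).
  have yE n : y (n + 1 + 1) = c n by apply: castE.
  have [s us [hs _]] := h4 z.
  pose up (k : {classic int}) : {classic int} := (k : int) + 1.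
  have [|v vE] := dmk y [seq up k | k <- s].
    move=> k; have [m ->] := shift k; have [n ->] := shift m => ks.
    rewrite yE; apply: (proj2 (cP n)); apply: hs; apply: contra ks => ks.
    exact: (map_f up ks).
  exists v; apply: ii; rewrite pE; apply: h3 => m; have [n ->] := shift m.
  by rewrite dlE vE yE (proj1 (cP n)).
have hs : ses i p.
  split=> // u; rewrite -iP -pE; split=> [->|]; first by rewrite linear0.
  by rewrite -{1}(linear0 i) => /ii.
exists A.
  exists D, i, p; split=> //; first exact: dsum_projective h1 h2 h4 projP.
  move=> Y hY g.
  have [h hE] := dep_choice (fun n => homP Y hY n (lcomp (lcomp g p) (inc (n + 1)))
    (fun x => ltac:(by rewrite /= -dl_inc -pE (ses0 _ hs) linear0))).
  have [H HE] := dsum_lift h1 h2 h4 h; exists H => a; have [u <-] := sp a.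
  apply: (dsum_eq h4 (f := lcomp H (lcomp i p)) (g := lcomp g p)) => k x.
  have [n e] := shift k; subst k.
  by rewrite /= pE dl_inc HE -hE.
have [u uE] : exists u : {linear G -> A}, forall x, i (u x) = lcomp (inc (n0 + 1)) j x.
  apply: factor_inj ii _ => x; apply/iP; rewrite /= dl_inc.
  by rewrite (iffRL (jP _)) ?linear0 //; exists x.
have [r rE] : exists r : {linear A -> G}, forall x, j (r x) = lcomp (pr (n0 + 1)) i x.
  apply: factor_inj ij _ => x; apply/jP; rewrite /= -dlE.
  by rewrite (iffRL (iP _)) ?linear0 //; exists x.
by exists u, r => x; apply: ij; rewrite rE /= uE /= h1.
Qed.

End GorensteinProjective.

Theorem corollary4p9 (d : nat) (R : comPzRingType)
    (hcoh : coherent R) (hperf : perfect d R) (M : lmodType R) :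
  exists (G : lmodType R) (phi : {linear G -> M}),
    gorenstein_projective_precover phi.
Proof.
have [E [bE cogen]] := inj_cogenerator R.
(* The relations among the generators of [X] indexed by codes, and their images in [M]; together
   they determine [X -> M] up to isomorphism. *)
pose J := ((seq (R * code M) -> Prop) * (code M -> M))%type.
pose T := {A : lmodType R & {linear A -> M}}.
pose approx (c : J) (t : T) := exists (X : lmodType R) (w : code M -> X)
    (f : {linear X -> M}) (L : lmodType R) (l : {linear L -> projT1 t}) (a : {linear projT1 t -> X}),
  [/\ c.1 = (fun s => leval (lsubst w s) = 0), c.2 = f \o w,
      sgp_orth L, ses l a & forall x, projT2 t x = f (a x)].
have [t tP] : exists t : J -> T, forall c, sgp (projT1 (t c)) /\
    ((exists2 u, sgp (projT1 u) & approx c u) -> approx c (t c)).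
  apply: (@dep_choice J (fun=> T) (fun c t => sgp (projT1 t) /\
    ((exists2 u, sgp (projT1 u) & approx c u) -> approx c t))) => c.
  have [[u hu]|n] := pselect (exists2 u, sgp (projT1 u) & approx c u); first by exists u.
  (* A harmless summand for those indices that admit no approximation. *)
  exists (existT _ (R^o : lmodType R) (lzero _ M)); split=> //.
  exact: proj_sgp (@proj_regular R).
have [D [inc [pr [h1 h2 h3 h4]]]] := dsum_ex (fun c => projT1 (t c)).
have [phi phiE] := dsum_lift h1 h2 h4 (fun c => projT2 (t c)).
exists D, phi; split.
  by apply: sgp_gorenstein; apply: (sgp_dsum h1 h2 h3 h4) => c; case: (tP c).
move=> G f /gorenstein_retract[A hA [u [r ru]]].
have [Q [i [p hd]]] := hA; have [_ hs _] := hd.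
have [S [X [F [iF [pF [pQ [pA [fX [w [gS hq fE sw]]]]]]]]]] := small_quotient (lcomp f r) hs.
have [fF hF] := quotient_pair_flat bE cogen hperf hd gS hq.
have [hsF _ _ _ _] := hq.
have [L [B [l [a [hB hla oL]]]]] := sgp_approximation bE cogen hcoh hperf hsF
  (eflat_dual_baer bE fF) (eflat_pd bE cogen hperf fF) hF.
pose c : J := (fun s => leval (lsubst w s) = 0, fX \o w).
have [_ /(_ _)[|X2 [w2 [f2 [L2 [l2 [a2 [c1 c2 oL2 hla2 tE]]]]]]]] := tP c.
  by exists (existT _ B (lcomp fX a)) => //; exists X, w, fX, L, l, a.
(* [X] and the module [X2] chosen for the index [c] have the same generators and relations, so
   sending [w k] to [w2 k] is well defined and compatible with the maps to [M]. *)
have [||h hG] := @lin_of_rel _ _ _ (fun x y => exists2 s : seq (R * code M),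
    x = leval (lsubst w s) & y = leval (lsubst w2 s)).
- split; first by exists [::]; rewrite leval_nil.
    move=> b _ _ _ _ [s -> ->] [s' -> ->].
    exists ([seq (b * z.1, z.2) | z <- s] ++ s').
      rewrite /lsubst map_cat leval_cat; congr (_ + _).
      rewrite /leval !big_map scaler_sumr; apply: eq_bigr => z _ /=.
      by rewrite scalerA.
    rewrite /lsubst map_cat leval_cat; congr (_ + _).
    rewrite /leval !big_map scaler_sumr; apply: eq_bigr => z _ /=.
    by rewrite scalerA.
  by move=> y [s /esym s0 ->]; have := congr1 (fun P => P s) c1 => /= <-.
- move=> x; have [k <-] := sw x; exists (w2 k), [:: (1, k)];
  by rewrite !levalE scale1r addr0.
have fh x : f2 (h x) = fX x.
  have [s -> ->] := hG x; rewrite -!leval_lin !lsubst_comp.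
  by rewrite -[fX \o w]/(c.2) c2.
have [k kE] := sgp_orth_lift (lcomp h pA) oL2 hla2 hA.
exists (lcomp (lcomp (inc c) k) u) => x.
by rewrite /= phiE tE kE /= fh fE /= ru.
Qed.
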